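(* Let $\mathcal F$ be the union of the three sets $$\Big\{\sum_{n\ge0}\Big(\sum_{k=0}^n\binom{n}{k}^r\Big)z^n : r\ge 3\Big\},\quad \Big\{\sum_{n\ge0}\Big(\sum_{k=0}^n\binom{n}{k}^r\binom{n+k}{k}^r\Big)z^n : r\ge 2\Big\},$$ $$\Big\{\sum_{n\ge0}\Big(\sum_{k=0}^n\binom{n}{k}^{2r}\binom{n+k}{k}^r\Big)z^n : r\ge 1\Big\}.$$ Then the elements of $\mathcal F$ are algebraically independent over $\mathbb C(z)$ (i.e., every finite subset of $\mathcal F$ consists of algebraically independent functions). *)

(* Defs.v *)
From HB Require Import structures.
From mathcomp Require Import all_boot all_order all_algebra.
From mathcomp Require Import boolp classical_sets reals complex mpoly.

Set Implicit Arguments.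
Unset Strict Implicit.
Unset Printing Implicit Defensive.

Import GRing.Theory.
Local Open Scope ring_scope.
Local Open Scope quotient_scope.
Local Open Scope classical_set_scope.

Record fps (R : Type) := FPS { fps_coef : nat -> R }.

(* Equality and choice are the classical ones on function spaces. *)
HB.instance Definition _ (R : Type) := gen_eqMixin (fps R).
HB.instance Definition _ (R : Type) := gen_choiceMixin (fps R).

Lemma fpsP (R : Type) (f g : fps R) : fps_coef f =1 fps_coef g -> f = g.
Proof. by case: f g => [f] [g] /= /funext ->. Qed.

Section FpsRing.
Variable R : comNzRingType.
Implicit Types f g h : fps R.

Definition fps_zero : fps R := FPS (fun _ => 0).
Definition fps_one : fps R := FPS (fun n => (n == 0)%:R).
Definition fps_opp f : fps R := FPS (fun n => - fps_coef f n).
Definition fps_add f g : fps R := FPS (fun n => fps_coef f n + fps_coef g n).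
Definition fps_mul f g : fps R :=
  FPS (fun n => \sum_(i < n.+1) fps_coef f i * fps_coef g (n - i)%N).

Lemma fps_addA : associative fps_add.
Proof. by move=> f g h; apply: fpsP => n /=; rewrite addrA. Qed.
Lemma fps_addC : commutative fps_add.
Proof. by move=> f g; apply: fpsP => n /=; rewrite addrC. Qed.
Lemma fps_add0 : left_id fps_zero fps_add.
Proof. by move=> f; apply: fpsP => n /=; rewrite add0r. Qed.
Lemma fps_addN : left_inverse fps_zero fps_opp fps_add.
Proof. by move=> f; apply: fpsP => n /=; rewrite addNr. Qed.

HB.instance Definition _ :=
  GRing.isZmodule.Build (fps R) fps_addA fps_addC fps_add0 fps_addN.

Definition fps_trunc m f : {poly R} := \poly_(i < m) fps_coef f i.

Lemma coef_fps_mul m f g (p q : {poly R}) :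
  (forall i, (i <= m)%N -> p`_i = fps_coef f i) ->
  (forall i, (i <= m)%N -> q`_i = fps_coef g i) ->
  forall i, (i <= m)%N -> (p * q)`_i = fps_coef (fps_mul f g) i.
Proof.
move=> hp hq i le_im; rewrite coefM /=; apply: eq_bigr => j _.
rewrite hp ?hq //; last exact: leq_trans (leq_ord j) le_im.
exact: leq_trans (leq_subr _ _) le_im.
Qed.

Lemma coef_fps_trunc m f i : (i <= m)%N -> (fps_trunc m.+1 f)`_i = fps_coef f i.
Proof. by move=> le_im; rewrite coef_poly ltnS le_im. Qed.

Lemma fps_mulA : associative fps_mul.
Proof.
move=> f g h; apply: fpsP => n; have T := @coef_fps_trunc n.
rewrite -(coef_fps_mul (T f) (coef_fps_mul (T g) (T h)) (leqnn n)).
by rewrite -(coef_fps_mul (coef_fps_mul (T f) (T g)) (T h) (leqnn n)) mulrA.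
Qed.

Lemma fps_mulC : commutative fps_mul.
Proof.
move=> f g; apply: fpsP => n; have T := @coef_fps_trunc n.
rewrite -(coef_fps_mul (T f) (T g) (leqnn n)).
by rewrite -(coef_fps_mul (T g) (T f) (leqnn n)) mulrC.
Qed.

Lemma fps_mul1 : left_id fps_one fps_mul.
Proof.
move=> f; apply: fpsP => n /=.
by rewrite big_ord_recl /= mul1r subn0 big1 ?addr0 // => i _; rewrite mul0r.
Qed.

Lemma fps_mulDl : left_distributive fps_mul fps_add.
Proof.
move=> f g h; apply: fpsP => n /=.
by rewrite -big_split; apply: eq_bigr => i _; rewrite /= mulrDl.
Qed.

Lemma fps_one_neq0 : fps_one != 0 :> fps R.
Proof.
by apply/eqP => /(congr1 (fun f => fps_coef f 0)) /= /eqP; rewrite oner_eq0.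
Qed.

HB.instance Definition _ := GRing.Zmodule_isComNzRing.Build (fps R)
  fps_mulA fps_mulC fps_mul1 fps_mulDl fps_one_neq0.

Definition fps_unit : pred (fps R) := fun f => `[< exists g, g * f = 1 >].
Definition fps_inv f : fps R :=
  if pselect (exists g, g * f = 1) is left fV then projT1 (cid fV) else f.

Lemma fps_mulV : {in fps_unit, left_inverse 1 fps_inv *%R}.
Proof.
move=> f /asboolP fV; rewrite /fps_inv; case: pselect => // fV'.
by case: cid.
Qed.
Lemma fps_unitPl f g : g * f = 1 -> fps_unit f.
Proof. by move=> gf1; apply/asboolP; exists g. Qed.
Lemma fps_inv_out : {in [predC fps_unit], fps_inv =1 id}.
Proof.
move=> f /negP nfV; rewrite /fps_inv; case: pselect => // fV.
by case: nfV; apply/asboolP.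
Qed.

HB.instance Definition _ := GRing.ComNzRing_hasMulInverse.Build (fps R)
  fps_mulV fps_unitPl fps_inv_out.

Definition poly_fps (p : {poly R}) : fps R := FPS (fun n => p`_n).

Lemma poly_fps_is_zmod_morphism : zmod_morphism poly_fps.
Proof. by move=> p q; apply: fpsP => n; rewrite /= coefB. Qed.
Lemma poly_fps_is_monoid_morphism : monoid_morphism poly_fps.
Proof.
by split=> [|p q]; apply: fpsP => n /=; [rewrite coef1 | rewrite coefM].
Qed.

HB.instance Definition _ := GRing.isZmodMorphism.Build {poly R} (fps R)
  poly_fps poly_fps_is_zmod_morphism.
HB.instance Definition _ := GRing.isMonoidMorphism.Build {poly R} (fps R)
  poly_fps poly_fps_is_monoid_morphism.

Lemma poly_fps_inj : injective poly_fps.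
Proof. by move=> p q [/funeqP pq]; apply/polyP => n; exact: pq. Qed.

End FpsRing.

Lemma fps_neq0 (R : comNzRingType) (f : fps R) : f != 0 ->
  exists2 n, fps_coef f n != 0 & forall i, (i < n)%N -> fps_coef f i = 0.
Proof.
move=> /eqP f0; have [n fn] : exists n, fps_coef f n != 0.
  apply: contra_notP f0 => /forallNP fn0; apply: fpsP => n.
  by apply/eqP/negPn/negP; exact: fn0.
have [m fm m_min] := ex_minnP (ex_intro (fun n => fps_coef f n != 0) n fn).
exists m => // i lt_im; apply/eqP; apply: contraTT lt_im => /m_min.
by rewrite -leqNgt.
Qed.

Lemma fps_integral (R : idomainType) (f g : fps R) :
  f * g = 0 -> (f == 0) || (g == 0).
Proof.
move=> fg0; apply/orP; case: eqVneq => [|/fps_neq0[m fm fm0]]; first by left.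
case: eqVneq => [|/fps_neq0[n gn gn0]]; first by right.
have /= := congr1 (fun f => fps_coef f (m + n)%N) fg0.
have lt_m : (m < (m + n).+1)%N by rewrite ltnS leq_addr.
rewrite (bigD1 (Ordinal lt_m)) //= addKn big1 ?addr0 => [/eqP|i].
  by rewrite mulf_eq0 (negPf fm) (negPf gn).
rewrite -val_eqE /= neq_ltn => /orP[lt_im|lt_mi].
  by rewrite fm0 ?mul0r.
by rewrite gn0 ?mulr0 // ltn_subLR ?ltn_add2r // -ltnS.
Qed.

HB.instance Definition _ (R : idomainType) :=
  GRing.ComUnitRing_isIntegral.Build (fps R) (@fps_integral R).

(* K(z) is {fraction {poly K}}, K((z)) is {fraction (fps K)}. *)
Section Ratfun.
Variable K : fieldType.
Local Notation tofrac := (@FracField.tofrac _).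

Definition ratfun_laurent (q : {fraction {poly K}}) : {fraction (fps K)} :=
  tofrac (poly_fps \n_(repr q)) / tofrac (poly_fps \d_(repr q)).

Lemma fracE (A : idomainType) (q : {fraction A}) :
  q = tofrac \n_(repr q) / tofrac \d_(repr q).
Proof.
have d0 : tofrac \d_(repr q) != 0 by rewrite tofrac_eq0 denom_ratioP.
apply: (mulIf d0); rewrite divfK // -{1}[q]reprK.
set x := repr q; unlock FracField.tofrac; rewrite -[LHS]FracField.pi_mul.
apply/eqmodP; rewrite /= FracField.equivfE /FracField.mulf.
by rewrite !numden_Ratio ?oner_eq0 ?mulr1 ?denom_ratioP // mulrC.
Qed.

Lemma poly_fps_frac_eq0 p : (tofrac (poly_fps p : fps K) == 0) = (p == 0).
Proof.
by rewrite tofrac_eq0 -(rmorph0 (@poly_fps K)) (inj_eq (@poly_fps_inj K)).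
Qed.

Lemma ratfun_laurentE (n d : {poly K}) : d != 0 ->
  ratfun_laurent (tofrac n / tofrac d) =
    tofrac (poly_fps n) / tofrac (poly_fps d).
Proof.
move=> d0; have /eqP := fracE (tofrac n / tofrac d).
rewrite /ratfun_laurent; move: (repr _) => x.
have dx0 := denom_ratioP x.
rewrite eqr_div ?tofrac_eq0 // -!tofracM tofrac_eq => /eqP nx.
apply/eqP; rewrite eqr_div ?poly_fps_frac_eq0 //.
by rewrite -!tofracM -!rmorphM nx mulrC.
Qed.

Lemma ratfun_laurent_is_zmod_morphism : zmod_morphism ratfun_laurent.
Proof.
move=> a b; rewrite (fracE a) (fracE b).
move: (repr a) (repr b) => x y; have [dx dy] := (denom_ratioP x, denom_ratioP y).
rewrite -mulNr addf_div ?tofrac_eq0 // -!tofracN -!tofracM -tofracD.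
rewrite !ratfun_laurentE ?mulf_neq0 // -mulNr addf_div ?poly_fps_frac_eq0 //.
by rewrite -!tofracN -!tofracM -tofracD -!rmorphN -!rmorphM -rmorphD.
Qed.

Lemma ratfun_laurent_is_monoid_morphism : monoid_morphism ratfun_laurent.
Proof.
split=> [|a b].
  rewrite -[1]divr1 -tofrac1 ratfun_laurentE ?oner_eq0 //.
  by rewrite rmorph1 tofrac1 divr1.
rewrite (fracE a) (fracE b).
move: (repr a) (repr b) => x y; have [dx dy] := (denom_ratioP x, denom_ratioP y).
rewrite mulf_div -!tofracM !ratfun_laurentE ?mulf_neq0 // mulf_div.
by rewrite -!tofracM -!rmorphM.
Qed.

HB.instance Definition _ := GRing.isZmodMorphism.Build
  {fraction {poly K}} {fraction (fps K)} ratfun_laurent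
  ratfun_laurent_is_zmod_morphism.
HB.instance Definition _ := GRing.isMonoidMorphism.Build
  {fraction {poly K}} {fraction (fps K)} ratfun_laurent
  ratfun_laurent_is_monoid_morphism.

End Ratfun.

Definition algebraically_independent (K L : fieldType)
    (iota : {rmorphism K -> L}) (S : set L) : Prop :=
  forall (m : nat) (x : 'I_m -> L), injective x -> (forall i, S (x i)) ->
  forall P : {mpoly K[m]}, mmap iota x P = 0 -> P = 0.

Section Family.
Variable K : fieldType.

Definition franel (r : nat) : fps K :=
  FPS (fun n => (\sum_(k < n.+1) 'C(n, k) ^ r)%N%:R).
Definition apery (r : nat) : fps K :=
  FPS (fun n => (\sum_(k < n.+1) 'C(n, k) ^ r * 'C(n + k, k) ^ r)%N%:R).
Definition apery2 (r : nat) : fps K :=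
  FPS (fun n => (\sum_(k < n.+1) 'C(n, k) ^ (2 * r) * 'C(n + k, k) ^ r)%N%:R).

Definition calF : set (fps K) :=
  [set franel r | r in [set r | 3 <= r]%N] `|`
  [set apery r | r in [set r | 2 <= r]%N] `|`
  [set apery2 r | r in [set r | 1 <= r]%N].

End Family.

(* Main.v *)
From HB Require Import structures.
Require Import Defs.
From mathcomp Require Import all_boot all_order all_algebra.
From mathcomp Require Import boolp classical_sets reals complex mpoly.
From mathcomp Require Import finfield Rstruct ring lra zify.
From Stdlib Require Rdefinitions.
From Coquelicot Require Rbar Series PSeries.

Set Implicit Arguments.
Unset Strict Implicit.
Unset Printing Implicit Defensive.
Import Order.TTheory GRing.Theory Num.Theory.
Local Open Scope ring_scope.

(** All series f in the family satisfy the Lucas congruences, so modulo a prime p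
  they obey f = A f^p with A a polynomial of degree less than p; every monomial g
  in them likewise obeys g = B g^p. Comparing a shortest
  polynomial relation between monomials modulo p with its p-th power leaves
  (c_s g_s)^(p-1) = (c_t g_t)^(p-1) for two monomials, hence
  Q g_s = P g_t with P, Q coprime, and B g^(p-1) = 1 bounds their degrees
  independently of p. Vanishing of integral minors transports an algebraic
  relation over C(z) to every p, and back to a relation Q g_s = P g_t over the
  reals. Such a relation cannot hold: near the smallest radius of
  convergence rho of a series F whose exponents differ, the other factors are
  analytic and nonzero, so F^a = (rho - z)^k V with V analytic and V(rho) <> 0.
  The bound O(rho^(-n) / n) on the coefficients excludes k <> 0, and a polynomial
  lower bound for the coefficients times rho^n excludes k = 0. The radii are
  (1/2)^r, (1 + sqrt 2)^(-2 r), ((1 + sqrt 5) / 2)^(-5 r), pairwise distinct. *)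

(** * Lucas congruences and Frobenius *)

(** The detour through F_p pays off because the degree bound on P and Q does not depend on p.
    Relations of bounded degree between two fixed monomials form a linear system of fixed width with
    integral entries, so one nonzero minor per pair, and a prime exceeding the product of these
    minors, are enough to return to characteristic zero. Integral minors do not see the field
    either: a complex relation is exchanged for a real one, where positivity of the coefficients can
    be used. At rho the logarithmic derivative of the relation is a linear equation D F' = E F. If
    F^a has a pole, the equation bounds F by a multiple of (rho - x) F', which the upper bound on
    the coefficients keeps bounded; a zero is excluded by F >= 1. If k = 0 the equation is regular
    at rho, so every derivative of F stays bounded, whereas the lower bound makes a high one
    diverge. The factor 1 / n in the upper bound takes three binomial factors: one is a probability
    summing to 1, and two others contribute n^(-1/2) each. This is the origin of the thresholds 3,
    2, 1 on r. *)

Section FpsModP.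
Variable p : nat.
Hypothesis p_prime : prime p.
Local Notation Fp := 'F_p.
Implicit Types (f g : fps Fp) (q : {poly Fp}).

(** The series f(z^p). *)
Definition fps_spread f : fps Fp :=
  FPS (fun n => if (p %| n)%N then fps_coef f (n %/ p) else 0).

(** Frobenius is additive and fixes the constants of F_p, so induction on q X + c applies. *)
Lemma coef_poly_frobenius q n :
  (q ^+ p)`_n = if (p %| n)%N then q`_(n %/ p) else 0.
Proof.
have p_gt0 := prime_gt0 p_prime.
have pcharP : p \in [pchar {poly Fp}].
  by rewrite pchar_poly pchar_Fp.
elim/poly_ind: q n => [|q c IHq] n.
  by rewrite expr0n gtn_eqF //= !coef0; case: ifP.
rewrite -(pFrobenius_autE pcharP) pFrobenius_autD_comm; last exact: mulrC.
rewrite !pFrobenius_autE exprMn coefD coefMXn -polyC_exp.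
have -> : c ^+ p = c by have := expf_card c; rewrite card_Fp.
rewrite coefC coefD coefMX coefC IHq.
have [n_p|p_n] := ltnP n p.
  rewrite add0r divn_small // eqxx add0r.
  case: n n_p => [|n] n_p; first by rewrite dvdn0.
  by rewrite gtnNdvd.
rewrite dvdn_subl //; have n0 : (n == 0%N) = false by rewrite gtn_eqF // (leq_trans p_gt0).
rewrite n0 addr0; case: ifP => // p_dvd.
have -> : ((n - p) %/ p = (n %/ p).-1)%N by rewrite -{1}(mul1n p) divnBMl subn1.
by rewrite -(divn_gt0 _ p_gt0) in p_n; rewrite gtn_eqF // addr0.
Qed.

Lemma coef_fps_exp (R : comNzRingType) (f : fps R) (q : {poly R}) m k :
    (forall i, (i <= m)%N -> q`_i = fps_coef f i) ->
  forall i, (i <= m)%N -> (q ^+ k)`_i = fps_coef (f ^+ k) i.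
Proof.
move=> qf; elim: k => [|k IHk] i im; first by rewrite !expr0 coef1.
by rewrite !exprS; apply: (coef_fps_mul qf IHk).
Qed.

Lemma fps_frobenius f : f ^+ p = fps_spread f.
Proof.
apply: fpsP => n; have T i : (i <= n)%N -> (fps_trunc n.+1 f)`_i = fps_coef f i.
  exact: coef_fps_trunc.
rewrite -(coef_fps_exp _ T) // coef_poly_frobenius /=.
by case: ifP => // _; rewrite T ?leq_div.
Qed.

(** As q has degree below p, uniqueness of division by p leaves a single term of the Cauchy
    product. *)
Lemma coef_fps_spreadM f q n : (size q <= p)%N ->
  fps_coef (fps_spread f * poly_fps q) n = fps_coef f (n %/ p) * q`_(n %% p).
Proof.
move=> qp; have lt_n : (n %/ p * p < n.+1)%N by rewrite ltnS leq_trunc_div.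
change (\sum_(i < n.+1) fps_coef (fps_spread f) i * q`_(n - i) = fps_coef f (n %/ p) * q`_(n %% p)).
rewrite (bigD1 (Ordinal lt_n)) //= dvdn_mull // mulnK ?prime_gt0 // big1 ?addr0.
  by rewrite {2}(divn_eq n p) addKn.
move=> i; rewrite -val_eqE /= => i_n; case: ifP => [/dvdnP[k ik]|_]; last by rewrite mul0r.
rewrite ik in i_n *; rewrite nth_default ?mulr0 //; apply: leq_trans qp _.
have := ltn_ord i; rewrite ik ltnS => kp_n.
have k_le : (k <= n %/ p)%N by rewrite leq_divRL ?prime_gt0.
have k_lt : (k < n %/ p)%N.
  by rewrite ltn_neqAle k_le andbT; apply: contraNneq i_n => ->.
by rewrite leq_subRL // -mulSnr; apply: leq_trans (leq_trunc_div n p); rewrite leq_mul2r k_lt orbT.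
Qed.

(** Lucas' theorem, read off (1 + X)^n = (1 + X^p)^(n / p) (1 + X)^(n mod p). *)
Lemma lucas_binomial n k :
  ('C(n, k)%:R : Fp) = 'C(n %/ p, k %/ p)%:R * 'C(n %% p, k %% p)%:R.
Proof.
have coef_1X m j : ((1 + 'X : {poly Fp}) ^+ m)`_j = 'C(m, j)%:R.
  rewrite addrC exprDn coef_sum.
  under eq_bigr => i _ do rewrite expr1n mulr1 coefMn coefXn.
  have [jm|mj] := leqP j m; last first.
    rewrite bin_small // big1 // => i _.
    by rewrite gtn_eqF ?mul0rn // (leq_ltn_trans (leq_subr _ _) mj).
  rewrite (bigD1 (inord (m - j))) //= inordK ?ltnS ?leq_subr // subKn // eqxx.
  rewrite bin_sub // big1 ?addr0 // => i; rewrite -val_eqE /= inordK ?ltnS ?leq_subr //.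
  move=> i_mj; rewrite [_ == _]negbTE ?mul0rn //; apply: contraNneq i_mj => ->.
  by rewrite subKn // -ltnS.
have -> : 'C(n, k)%:R = fps_coef (poly_fps ((1 + 'X : {poly Fp}) ^+ n)) k.
  by rewrite /= coef_1X.
have -> : poly_fps ((1 + 'X : {poly Fp}) ^+ n) =
    fps_spread (poly_fps ((1 + 'X) ^+ (n %/ p))) * poly_fps ((1 + 'X) ^+ (n %% p)).
  by rewrite -fps_frobenius -rmorphXn -rmorphM /= -exprM -exprD -divn_eq.
rewrite coef_fps_spreadM /= ?coef_1X //.
rewrite (leq_trans (size_poly_exp_leq _ _)) // addrC -polyC1 size_XaddC.
by rewrite mul1n ltn_pmod ?prime_gt0.
Qed.

(** Without a carry in the last digit this is Lucas' theorem for n + k. With a carry, the last digit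
    of n + k drops below that of k and both sides vanish. *)
Lemma lucas_binomial_shift n k :
  ('C(n + k, k)%:R : Fp) =
    'C(n %/ p + k %/ p, k %/ p)%:R * 'C(n %% p + k %% p, k %% p)%:R.
Proof.
have p_gt0 := prime_gt0 p_prime.
have [lt_p|le_p] := ltnP (n %% p + k %% p) p.
  have -> : (n + k = (n %/ p + k %/ p) * p + (n %% p + k %% p))%N.
    by rewrite mulnDl addnACA -!divn_eq.
  by rewrite lucas_binomial divnMDl // (divn_small lt_p) addn0 modnMDl (modn_small lt_p).
have lt_k : (n %% p + k %% p - p < k %% p)%N.
  by rewrite ltn_subLR // ltn_add2r ltn_pmod.
have lt_p : (n %% p + k %% p - p < p)%N by rewrite (ltn_trans lt_k) ?ltn_pmod.
have mod_nk : ((n %% p + k %% p) %% p = n %% p + k %% p - p)%N.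
  by rewrite -{1}(subnK le_p) modnDr modn_small.
rewrite (lucas_binomial (n + k)) -(modnDm n k) mod_nk (bin_small lt_k) mulr0.
by rewrite (lucas_binomial (n %% p + _)) mod_nk modn_mod (bin_small lt_k) !mulr0.
Qed.

Definition lucas_seq (c : nat -> nat) :=
  forall n, (c n)%:R = (c (n %/ p)%N)%:R * (c (n %% p)%N)%:R :> Fp.

Lemma sum_nat_mul (V : nmodType) (F : nat -> V) m :
  \sum_(0 <= k < m * p) F k =
  \sum_(0 <= i < m) \sum_(0 <= j < p) F (i * p + j)%N.
Proof.
elim: m => [|m IHm]; first by rewrite mul0n !big_geq.
rewrite big_nat_recr //= -IHm mulSnr (big_cat_nat _ (n := (m * p)%N)) ?leq_addr //=.
congr (_ + _); rewrite -{1}(add0n (m * p)%N) big_addn addKn.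
by apply: eq_bigr => j _; rewrite addnC.
Qed.

Lemma lucas_binsum e1 e2 : (0 < e1)%N ->
  lucas_seq (fun n => \sum_(k < n.+1) 'C(n, k) ^ e1 * 'C(n + k, k) ^ e2)%N.
Proof.
move=> e1_gt0 n; have p_gt0 := prime_gt0 p_prime.
pose T n k : Fp := ('C(n, k) ^ e1 * 'C(n + k, k) ^ e2)%:R.
have TE m : (\sum_(k < m.+1) 'C(m, k) ^ e1 * 'C(m + k, k) ^ e2)%N%:R =
    \sum_(0 <= k < m.+1) T m k by rewrite natr_sum big_mkord.
have T0 m k : (m < k)%N -> T m k = 0.
  by move=> mk; rewrite /T bin_small // exp0n ?mul0n.
have widen m j : (m < j)%N -> \sum_(0 <= k < m.+1) T m k = \sum_(0 <= k < j) T m k.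
  move=> mj; rewrite (big_cat_nat _ (n := m.+1) (p := j)) //=.
  have -> : \sum_(m.+1 <= k < j) T m k = 0.
    by rewrite big_nat big1 // => i /andP[mi _]; apply: T0.
  by rewrite addr0.
(* Terms with k > n vanish because [e1] is positive; once the range is a multiple of p, the two
   parts of k = i p + j vary independently and the sum factors. *)
rewrite !TE (@widen n ((n %/ p).+1 * p)%N) ?ltn_ceil // sum_nat_mul.
rewrite (@widen (n %% p)%N p) ?ltn_pmod // mulr_suml.
rewrite !big_nat; apply: eq_bigr => i _; rewrite mulr_sumr.
rewrite !big_nat; apply: eq_bigr => j /andP[_ jp].
rewrite /T !natrM !natrX (lucas_binomial n) (lucas_binomial_shift n).
rewrite divnMDl // (divn_small jp) addn0 modnMDl (modn_small jp) !exprMn.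
by rewrite mulrACA.
Qed.

Definition nat_fps (K : comNzRingType) (c : nat -> nat) : fps K :=
  FPS (fun n => (c n)%:R).

Lemma lucas_fps c : lucas_seq c ->
  nat_fps Fp c = poly_fps (\poly_(i < p) (c i)%:R) * nat_fps Fp c ^+ p.
Proof.
move=> c_lucas; apply: fpsP => n; rewrite mulrC fps_frobenius.
by rewrite coef_fps_spreadM ?size_poly // coef_poly ltn_pmod ?prime_gt0 //= c_lucas.
Qed.

(** In the fraction field x / y is a root of X^p - X, which is the product of the X - z over z in
    F_p; so x / y is a constant. *)
Lemma fps_pred_power_eq (x y : fps Fp) : y != 0 -> x ^+ p.-1 = y ^+ p.-1 ->
  exists2 z : Fp, z != 0 & x = poly_fps z%:P * y.
Proof.
move=> y0 xy; have p_gt0 := prime_gt0 p_prime.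
pose tofr := @FracField.tofrac (fps Fp).
pose phi := (tofr \o (@poly_fps Fp \o polyC)) : {rmorphism Fp -> {fraction (fps Fp)}}.
pose t := tofr x / tofr y.
have ty0 : tofr y != 0 by rewrite tofrac_eq0.
have t1 : t ^+ p.-1 = 1.
  by rewrite exprMn exprVn -!tofracXn xy mulfV // tofracXn expf_neq0.
have /(congr1 (fun q => (map_poly phi q).[t])) := finField_genPoly Fp.
rewrite rmorphB rmorph_prod /= horner_prod map_polyXn map_polyX !hornerE card_Fp //.
have -> : t ^+ p = t by rewrite -[X in _ ^+ X](prednK p_gt0) exprS t1 mulr1.
rewrite subrr => /esym/eqP/prodf_eq0[z _].
rewrite /= map_polyXsubC hornerXsubC subr_eq0 => /eqP tz.
have xz : x = poly_fps z%:P * y.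
  apply/eqP; rewrite -tofrac_eq tofracM; apply/eqP.
  by rewrite -[LHS](divfK ty0) -/t tz.
exists z => //; apply/eqP => z0; move: t1; rewrite /t /tofr xz z0 !rmorph0 mul0r tofrac0 mul0r.
rewrite expr0n gtn_eqF -?subn1 ?subn_gt0 ?prime_gt1 // => /eqP.
by rewrite eq_sym oner_eq0.
Qed.

Lemma poly_fps_eq0 (K : comNzRingType) (q : {poly K}) : (poly_fps q == 0) = (q == 0).
Proof. by rewrite -(rmorph0 (@poly_fps K)) (inj_eq (@poly_fps_inj K)). Qed.

(** * Shortest relations and their p-th powers *)

Section FrobeniusRelation.
Variables (I : finType) (g : I -> fps Fp) (B : I -> {poly Fp}).
Hypothesis g_neq0 : forall s, g s != 0.
Hypothesis gB : forall s, g s = poly_fps (B s) * g s ^+ p.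

Lemma frobenius_factor_neq0 s : B s != 0.
Proof.
by apply: contraNneq (g_neq0 s) => B0; rewrite gB B0 rmorph0 mul0r.
Qed.

Lemma frobenius_pred_power s : poly_fps (B s) * g s ^+ p.-1 = 1.
Proof.
by apply: (mulIf (g_neq0 s)); rewrite mul1r -mulrA -exprSr prednK ?prime_gt0.
Qed.

(* Comparing a relation with its p-th power, rewritten through [gB], eliminates
   a term unless the two relations are proportional. *)
Lemma frobenius_elimination (c : I -> {poly Fp}) :
    (exists s, c s != 0) -> \sum_s poly_fps (c s) * g s = 0 ->
  exists s t (a b : {poly Fp}), [/\ s != t, a != 0, b != 0 &
    a ^+ p.-1 * B t = b ^+ p.-1 * B s].
Proof.
have p_gt0 := prime_gt0 p_prime.
have [n] := ubnP #|[set s | c s != 0]|; elim: n c => // n IHn c c_n [s0 cs0] rel.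
(* Multiplying the p-th power of the relation by the product of all B turns its s-th term c_s^p
   g_s^p into c_s^p B'_s g_s, a relation between the same g. *)
pose B' s := \prod_(t | t != s) B t.
have BB' s : B s * B' s = \prod_t B t by rewrite [RHS](bigD1 s).
have relp : \sum_s poly_fps (c s ^+ p * B' s) * g s = 0.
  have : poly_fps (\prod_t B t) * (\sum_s poly_fps (c s) * g s) ^+ p = 0.
    by rewrite rel expr0n gtn_eqF // mulr0.
  have pcharP : p \in [pchar (fps Fp)].
    rewrite inE p_prime /=; apply/eqP; rewrite -(rmorph_nat (@poly_fps Fp)).
    by rewrite -polyC_natr pchar_Fp_0 // rmorph0.
  rewrite -(pFrobenius_autE pcharP) rmorph_sum /= mulr_sumr; apply: etrans.
  apply: eq_bigr => s _; rewrite pFrobenius_autE exprMn -rmorphXn -(BB' s).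
  by rewrite {1}gB !rmorphM /=; ring.
(* This combination kills the term [s0] and adds none, so unless it is identically zero the support
   shrinks and the induction applies. *)
pose c' s := c s0 * (c s ^+ p * B' s) - c s0 ^+ p * B' s0 * c s.
have rel' : \sum_s poly_fps (c' s) * g s = 0.
  transitivity (poly_fps (c s0) * (\sum_s poly_fps (c s ^+ p * B' s) * g s) -
      poly_fps (c s0 ^+ p * B' s0) * \sum_s poly_fps (c s) * g s).
    rewrite !mulr_sumr -sumrB; apply: eq_bigr => s _.
    by rewrite rmorphB !rmorphM /=; ring.
  by rewrite rel relp !mulr0 subrr.
have [/existsP c'0|] := boolP [exists s, c' s != 0].
  apply: (IHn c') => //; apply: leq_trans (_ : #|[set s | c s != 0%R]| <= n)%N => //.
  apply: proper_card; apply/properP; split; last first.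
    by exists s0; rewrite !inE // negbK /c' subr_eq0 mulrC.
  apply/fintype.subsetP => s; rewrite !inE; apply: contra => /eqP cs.
  by rewrite /c' cs expr0n gtn_eqF //= mul0r !mulr0 subrr.
rewrite negb_exists => /forallP c'0.
have [/existsP[s1 /andP[s10 cs1]]|] := boolP [exists s, (s != s0) && (c s != 0)].
  exists s1, s0, (c s1), (c s0); split=> //.
  have pX (x : {poly Fp}) : x ^+ p = x * x ^+ p.-1 by rewrite -exprS prednK.
  have B'0 s : B' s != 0 by apply/prodf_neq0 => t _; apply: frobenius_factor_neq0.
  have := c'0 s1; rewrite negbK /c' subr_eq0 => /eqP c'E.
  apply: (mulfI (mulf_neq0 cs0 cs1)); apply: (mulIf (B'0 s1)); apply: (mulIf (B'0 s0)).
  transitivity (c s0 * (c s1 ^+ p * B' s1) * (B s0 * B' s0)).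
    by rewrite (pX (c s1)); ring.
  by rewrite c'E BB' -(BB' s1) (pX (c s0)); ring.
rewrite negb_exists => /forallP c1; move: rel.
rewrite (bigD1 s0) //= big1 ?addr0 => [|s s_s0].
  by move/eqP; rewrite mulf_eq0 (negPf (g_neq0 s0)) orbF poly_fps_eq0 (negPf cs0).
by have := c1 s; rewrite s_s0 negbK => /eqP ->; rewrite rmorph0 mul0r.
Qed.

(** After division by the gcd, Q^(p-1) B_t = P^(p-1) B_s with P, Q coprime, so Q^(p-1) divides B_s
    and P^(p-1) divides B_t. Their degrees are at most D (p-1), and the factor p-1 cancels. *)
Lemma frobenius_relation (D : nat) (c : I -> {poly Fp}) :
    (forall s, size (B s) <= (D * p.-1).+1)%N ->
    (exists s, c s != 0) -> \sum_s poly_fps (c s) * g s = 0 ->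
  exists s t (P Q : {poly Fp}), [/\ s != t, P != 0,
    (size P <= D.+1)%N, (size Q <= D.+1)%N & poly_fps Q * g s = poly_fps P * g t].
Proof.
move=> sizeB c0 rel; have p_gt0 := prime_gt0 p_prime.
have [s [t [a [b [st a0 b0 ab]]]]] := frobenius_elimination c0 rel.
pose d := gcdp a b; have d0 : d != 0 by rewrite gcdp_eq0 (negPf a0).
pose Q := a %/ d; pose P := b %/ d.
have aE : a = Q * d by rewrite divpK ?dvdp_gcdl.
have bE : b = P * d by rewrite divpK ?dvdp_gcdr.
have PQ : coprimep Q P by rewrite coprimep_div_gcd ?a0.
have Q0 : Q != 0 by apply: contraNneq a0 => Q0; rewrite aE Q0 mul0r.
have P0 : P != 0 by apply: contraNneq b0 => P0; rewrite bE P0 mul0r.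
have QP : Q ^+ p.-1 * B t = P ^+ p.-1 * B s.
  apply: (mulfI (expf_neq0 p.-1 d0)); rewrite !mulrA -!exprMn mulrC.
  by rewrite [d * Q]mulrC [d * P]mulrC -aE -bE mulrC.
have p1 : (0 < p.-1)%N by rewrite -subn1 subn_gt0 prime_gt1.
have size_le (q r : {poly Fp}) : q != 0 -> r != 0 -> q ^+ p.-1 %| r ->
    (size r <= (D * p.-1).+1)%N -> (size q <= D.+1)%N.
  move=> q0 r0 /(dvdp_leq r0) qr rD; have := leq_trans qr rD.
  have sq0 : (0 < size q)%N by rewrite size_poly_gt0.
  have := size_exp q p.-1; case: (size (q ^+ _)) (size_poly_gt0 (q ^+ p.-1)).
    by rewrite expf_neq0.
  by move=> m _ /= ->; rewrite ltnS leq_pmul2r // -[in X in _ -> X](prednK sq0) ltnS.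
have sizeQ : (size Q <= D.+1)%N.
  apply: (size_le _ (B s)) => //; first exact: frobenius_factor_neq0.
  by rewrite -(@Gauss_dvdpr _ _ (P ^+ p.-1)) ?coprimep_expl ?coprimep_expr // -QP dvdp_mulr.
have sizeP : (size P <= D.+1)%N.
  apply: (size_le _ (B t)) => //; first exact: frobenius_factor_neq0.
  rewrite -(@Gauss_dvdpr _ _ (Q ^+ p.-1)) ?coprimep_expl ?coprimep_expr //.
    by rewrite QP dvdp_mulr.
  by rewrite coprimep_sym.
have [||z z0 Qz] := @fps_pred_power_eq (poly_fps Q * g s) (poly_fps P * g t).
- by rewrite mulf_neq0 // poly_fps_eq0.
- have := congr1 (fun q => poly_fps q * g s ^+ p.-1 * g t ^+ p.-1) QP.
  rewrite /= !rmorphM /= !rmorphXn /= => QPg; rewrite !exprMn.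
  rewrite -[LHS]mulr1 -(frobenius_pred_power t) -[RHS]mulr1 -(frobenius_pred_power s).
  move: QPg; move: (_ Q ^+ _) (_ P ^+ _) (_ (B t)) (_ (B s)) (g s ^+ _) (g t ^+ _).
  move=> a1 b1 bt bs x y h; transitivity (a1 * bt * x * y); first by ring.
  by rewrite h; ring.
(* The (p-1)-th root of unity left by taking roots is absorbed into P. *)
exists s, t, (z%:P * P), Q; split=> //.
- by rewrite mulf_neq0 // polyC_eq0.
- by rewrite mul_polyC size_scale.
- by rewrite Qz rmorphM mulrA.
Qed.

End FrobeniusRelation.

End FpsModP.

(** * Polynomial relations and integral minors *)

Lemma fps_coef_sum (R : comNzRingType) (I : Type) (r : seq I) (P : pred I)
    (F : I -> fps R) n :
  fps_coef (\sum_(i <- r | P i) F i) n = \sum_(i <- r | P i) fps_coef (F i) n.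
Proof. by elim/big_rec2: _ => // i x y _ <-. Qed.

Lemma fps_coefCM (R : comNzRingType) (a : R) (f : fps R) n :
  fps_coef (poly_fps a%:P * f) n = a * fps_coef f n.
Proof.
change (\sum_(i < n.+1) (a%:P)`_i * fps_coef f (n - i) = a * fps_coef f n).
rewrite big_ord_recl coefC subn0 big1 ?addr0 // => i _.
by rewrite coefC mul0r.
Qed.

Section SequenceMinors.
Variables (K : fieldType) (I : finType) (g : I -> nat -> K).

(** There are infinitely many equations in finitely many unknowns, so the ranks of the truncations
    reach a maximum. If it is the number of unknowns, some minor is nonzero; otherwise a kernel
    vector of one truncation of maximal rank solves every equation. *)
Lemma linear_dependence_minors :
  (exists2 c : I -> K, exists i, c i != 0 & forall n, \sum_i c i * g i n = 0) <->
  (forall phi : 'I_#|I| -> nat,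
     \det (\matrix_(i, j) g (enum_val j) (phi i)) = 0).
Proof.
split=> [[c [i0 ci0] cg] phi|minors0].
  rewrite -det_tr; apply/eqP/det0P; exists (\row_j c (enum_val j)).
    apply: contraNneq ci0 => /rowP/(_ (enum_rank i0)).
    by rewrite !mxE enum_rankK => ->.
  apply/rowP => i; rewrite !mxE -[RHS](cg (phi i)) (reindex _ (onW_bij _ (enum_val_bij I))).
  by apply: eq_bigr => j _; rewrite !mxE.
pose B M : 'M[K]_(M, #|I|) := \matrix_(i, j) g (enum_val j) i.
have exr : exists r, `[< exists M, \rank (B M) = r >].
  by exists (\rank (B 0)); apply/asboolP; exists 0%N.
have bdr r : `[< exists M, \rank (B M) = r >] -> (r <= #|I|)%N.
  by move/asboolP => [M <-]; apply: rank_leq_col.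
have [r /asboolP[M rM] r_max] := ex_maxnP exr bdr.
have rI : (r < #|I|)%N.
  rewrite ltn_neqAle -{2}rM rank_leq_col andbT; apply/eqP => rI.
  have full : row_full (B M) by rewrite /row_full rM rI.
  have := fullrowsub_unit full; rewrite unitmxE unitfE -(minors0 (fun i => fullrankfun full i)).
  by move=> /eqP; apply; congr (\det _); apply/matrixP => i j; rewrite !mxE.
have : kermx (B M)^T != 0 by rewrite kermx_eq0 /row_free mxrank_tr rM ltn_eqF.
case/rowV0Pn=> w /sub_kermxP wB w0; exists (fun i => w 0 (enum_rank i)).
  apply: contra_notP (elimN eqP w0) => /forallNP w0'; apply/rowP => j.
  by have := w0' (enum_val j); rewrite mxE enum_valK => /negP/negPn/eqP.
move=> n; pose M' := maxn M n.+1.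
(* By maximality of the rank, the longer truncation has the same row space, so [w] also annihilates
   row n. *)
have sub : (B M <= B M')%MS.
  apply/row_subP => i; have lt_i : (i < M')%N by rewrite (leq_trans (ltn_ord i)) ?leq_maxl.
  have -> : row i (B M) = row (Ordinal lt_i) (B M').
    by apply/rowP => j; rewrite !mxE.
  exact: row_sub.
have sub' : (B M' <= B M)%MS.
  have [_ <-] := mxrank_leqif_sup sub; rewrite rM eqn_leq -{1}rM mxrankS //=.
  by apply: r_max; apply/asboolP; exists M'.
have {sub'} /submxP[D BD] := sub'.
have lt_n : (n < M')%N by rewrite leq_maxr.
have : (w *m (B M')^T) 0 (Ordinal lt_n) = 0.
  by rewrite BD trmx_mul mulmxA wB mul0mx mxE.
rewrite mxE; apply: etrans; rewrite (reindex _ (onW_bij _ (enum_val_bij I))); apply: eq_bigr => j _.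
by rewrite !mxE enum_valK.
Qed.

End SequenceMinors.

Section FpsMap.
Variables (R S : comNzRingType) (phi : {rmorphism R -> S}).

Definition fps_map (f : fps R) : fps S := FPS (fun n => phi (fps_coef f n)).

Lemma fps_map_is_zmod_morphism : zmod_morphism fps_map.
Proof. by move=> f g; apply: fpsP => n; rewrite /= rmorphB. Qed.

Lemma fps_map_is_monoid_morphism : monoid_morphism fps_map.
Proof.
split=> [|f g]; apply: fpsP => n; first by rewrite /= rmorph_nat.
by rewrite /= rmorph_sum; apply: eq_bigr => i _; rewrite rmorphM.
Qed.

HB.instance Definition _ := GRing.isZmodMorphism.Build (fps R) (fps S)
  fps_map fps_map_is_zmod_morphism.
HB.instance Definition _ := GRing.isMonoidMorphism.Build (fps R) (fps S)
  fps_map fps_map_is_monoid_morphism.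

Lemma fps_map_poly (p : {poly R}) : fps_map (poly_fps p) = poly_fps (map_poly phi p).
Proof. by apply: fpsP => n; rewrite /= coef_map. Qed.

End FpsMap.

Lemma fps_map_nat (K : comNzRingType) (c : nat -> nat) :
  fps_map intr (nat_fps int c) = nat_fps K c.
Proof. by apply: fpsP => n; rewrite /= rmorph_nat. Qed.

(* The relations with coefficients of degree less than [d] among integral power
   series form a linear system over the integers, so their existence over a field
   is the vanishing of integral minors. *)
Section PolynomialRelations.
Variables (I : finType) (G : I -> fps int) (d : nat).

Definition fps_dependent (K : fieldType) :=
  exists c : I -> {poly K}, [/\ exists i, c i != 0, forall i, (size (c i) <= d)%N &
    \sum_i poly_fps (c i) * fps_map intr (G i) = 0].

(** Equation n of the system, at the unknown (i, j): the coefficient of z^j in the i-th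
    polynomial. *)
Definition integral_coef (x : I * 'I_d) (n : nat) : int :=
  fps_coef (poly_fps 'X^(x.2) * G x.1) n.

Definition integral_minor (phi : 'I_#|{: I * 'I_d}| -> nat) : int :=
  \det (\matrix_(i, j) integral_coef (enum_val j) (phi i)).

Lemma fps_dependentP (K : fieldType) :
  fps_dependent K <-> forall phi, (integral_minor phi)%:~R = 0 :> K.
Proof.
have relE (c : I -> 'I_d -> K) n :
    fps_coef (\sum_i poly_fps (\sum_(j < d) c i j *: 'X^j) * fps_map intr (G i)) n =
    \sum_x c x.1 x.2 * (integral_coef x n)%:~R.
  rewrite fps_coef_sum -(pair_bigA _ (fun i j => c i j * (integral_coef (i, j) n)%:~R)).
  apply: eq_bigr => i _. rewrite rmorph_sum mulr_suml fps_coef_sum.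
  apply: eq_bigr => j _; rewrite -mul_polyC rmorphM -mulrA fps_coefCM.
  suff -> : poly_fps ('X^j : {poly K}) * fps_map intr (G i) =
      fps_map intr (poly_fps 'X^j * G i) by [].
  by rewrite rmorphM /= fps_map_poly map_polyXn.
have minorE phi : (integral_minor phi)%:~R =
      \det (\matrix_(i, j) (integral_coef (enum_val j) (phi i))%:~R) :> K.
  rewrite /integral_minor -det_map_mx; congr (\det _).
  by apply/matrixP => i j; rewrite !mxE.
split=> [[c [[i0 ci0] sc rel]] phi|minor0].
  rewrite minorE.
  apply: ((linear_dependence_minors (fun x n => (integral_coef x n)%:~R : K)).1 _ phi).
  have cE i : c i = \sum_(j < d) (c i)`_j *: 'X^j.
    rewrite -poly_def; apply/polyP => j; rewrite coef_poly; case: ltnP => // dj.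
    by rewrite nth_default // (leq_trans (sc i)).
  exists (fun x : I * 'I_d => (c x.1)`_x.2) => [|n].
    have lt_d : ((size (c i0)).-1 < d)%N.
      by rewrite prednK ?size_poly_gt0 ?sc.
    by exists (i0, Ordinal lt_d); rewrite /= -lead_coefE lead_coef_eq0.
  rewrite -(relE (fun i j => (c i)`_j)).
  by under eq_bigr => i _ do rewrite -cE; rewrite rel.
have [phi|c [[i0 j0] c0] rel] :=
    (linear_dependence_minors (fun x n => (integral_coef x n)%:~R : K)).2.
  by rewrite -minorE.
exists (fun i => \sum_(j < d) c (i, j) *: 'X^j); split=> [|i|].
- exists i0; apply: contraNneq c0 => ci0.
  have := congr1 (fun q : {poly K} => q`_j0) ci0.
  rewrite /= coef0 coef_sum (bigD1 j0) //= coefZ coefXn eqxx mulr1 big1 ?addr0.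
    by move->.
  by move=> j j_j0; rewrite coefZ coefXn eq_sym val_eqE (negPf j_j0) mulr0.
- apply: (leq_trans (size_sum _ _ _)); apply/bigmax_leqP => j _.
  by apply: leq_trans (size_scale_leq _ _) _; rewrite size_polyXn.
apply: fpsP => n; rewrite (relE (fun i j => c (i, j))) -[RHS](rel n).
by apply: eq_bigr => -[i j].
Qed.

End PolynomialRelations.

(** * Coefficient asymptotics *)

Section BinomialDistribution.
Variable R : realType.
Implicit Types (u v q : R) (n k j : nat).

Definition binprob u n k : R := 'C(n, k)%:R * u ^+ k * (1 - u) ^+ (n - k).

Lemma binprob_ge0 u n k : 0 <= u <= 1 -> 0 <= binprob u n k.
Proof.
by move=> /andP[u0 u1]; rewrite !mulr_ge0 ?exprn_ge0 ?subr_ge0.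
Qed.

Lemma sum_binprob u n : \sum_(k < n.+1) binprob u n k = 1.
Proof.
rewrite -(expr1n _ n) -[X in X ^+ n](subrK u) exprDn.
by apply: eq_bigr => k _; rewrite -mulr_natl /binprob; ring.
Qed.

Lemma binprob_small u n k : (n < k)%N -> binprob u n k = 0.
Proof. by move=> nk; rewrite /binprob bin_small // !mul0r. Qed.

Lemma binprob_le1 u n k : 0 <= u <= 1 -> binprob u n k <= 1.
Proof.
move=> u01; have [nk|lt_nk] := leqP k n; last by rewrite binprob_small.
rewrite -[leRHS](sum_binprob u n) -ltnS in nk *.
rewrite (bigD1 (Ordinal nk)) //= lerDl sumr_ge0 // => i _; exact: binprob_ge0.
Qed.

Lemma binprob_step u n k : (k < n)%N ->
  k.+1%:R * (1 - u) * binprob u n k.+1 = (n - k)%:R * u * binprob u n k.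
Proof.
move=> kn; have := congr1 (fun m => m%:R : R) (mul_bin_left n k).
rewrite !natrM => Cnk; rewrite /binprob subnS exprS.
have -> : (1 - u) ^+ (n - k) = (1 - u) * (1 - u) ^+ (n - k).-1.
  by rewrite -exprS prednK ?subn_gt0.
transitivity (k.+1%:R * 'C(n, k.+1)%:R * (u * u ^+ k * (1 - u) * (1 - u) ^+ (n - k).-1)).
  by ring.
by rewrite Cnk; ring.
Qed.

(** By [binprob_step], passing from i to i + 1 increases the probability exactly as long as i + 1 <=
    (n + 1) u. *)
Lemma binprob_mode u n k j : 0 < u < 1 -> (k <= n)%N ->
  k%:R <= n.+1%:R * u <= k.+1%:R -> binprob u n j <= binprob u n k.
Proof.
move=> /andP[u0 u1] kn /andP[k_le le_k].
have u01 : 0 <= u <= 1 by rewrite !ltW.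
have [jn|lt_nj] := leqP j n; last by rewrite binprob_small ?binprob_ge0.
have [le_jk|/ltnW le_kj] := leqP j k.
  rewrite -(subKn le_jk); elim: (k - j)%N (leq_subr j k) => [|d IHd] dk.
    by rewrite subn0.
  apply: le_trans (IHd (ltnW dk)); set i := (k - d.+1)%N.
  have -> : (k - d = i.+1)%N by rewrite /i subnSK.
  have i_k : (i < k)%N by rewrite /i subnS prednK ?subn_gt0 ?leq_subr.
  have i_n := leq_trans i_k kn.
  have h0 : 0 < i.+1%:R * (1 - u) by rewrite mulr_gt0 ?ltr0n ?subr_gt0.
  rewrite -(ler_pM2l h0) binprob_step //.
  rewrite ler_wpM2r ?binprob_ge0 // natrB 1?ltnW //.
  have : i.+1%:R <= k%:R :> R by rewrite ler_nat.
  rewrite -!natr1 in k_le *; nra.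
rewrite -(subnKC le_kj); have : (k + (j - k) <= n)%N by rewrite subnKC.
elim: (j - k)%N => [|d IHd] dn; first by rewrite addn0.
rewrite addnS in dn *; apply: le_trans (IHd (ltnW dn)); set i := (k + d)%N in dn *.
have h0 : 0 < i.+1%:R * (1 - u) by rewrite mulr_gt0 ?ltr0n ?subr_gt0.
rewrite -(ler_pM2l h0) binprob_step //.
rewrite ler_wpM2r ?binprob_ge0 // natrB 1?ltnW //.
have : k%:R <= i%:R :> R by rewrite ler_nat leq_addr.
rewrite -!natr1 in le_k *; nra.
Qed.

(** The largest of n + 1 numbers with sum 1 is at least their mean. *)
Lemma binprob_mode_ge u n k : 0 < u < 1 -> (k <= n)%N ->
  k%:R <= n.+1%:R * u <= k.+1%:R -> n.+1%:R^-1 <= binprob u n k.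
Proof.
move=> u01 kn knu; rewrite -[leLHS]mul1r ler_pdivrMr ?ltr0n //.
rewrite -[leLHS](sum_binprob u n) mulr_natr -[X in _ <= _ *+ X]card_ord -sumr_const.
by apply: ler_sum => j _; apply: binprob_mode.
Qed.

Lemma bin_odd_middle m : 'C(m.*2.+1, m.+1) = 'C(m.*2.+1, m).
Proof.
have le_m : (m.+1 <= m.*2.+1)%N by rewrite ltnS -addnn leq_addr.
by rewrite -(bin_sub le_m) subSS -addnn addnK.
Qed.

Lemma bin_even_middle m : 'C(m.*2.+2, m.+1) = (2 * 'C(m.*2.+1, m))%N.
Proof. by rewrite binS bin_odd_middle mul2n addnn. Qed.

(** Consecutive central probabilities have ratio (2m+1) / (2m+2), and (2m+1)(2m+3) <= (2m+2)^2.
    Squaring avoids roots. *)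
Lemma central_binprob_le m : (m.*2.+1)%:R * binprob (1 / 2) m.*2 m ^+ 2 <= 1.
Proof.
elim: m => [|m IHm]; first by rewrite /binprob /= bin0 !expr0 !mulr1 expr1n mulr1.
have e12 : 1 - 1 / 2 = 1 / 2 :> R by field.
have wE k : binprob (1 / 2) k.*2 k = 'C(k.*2, k)%:R / 4 ^+ k.
  rewrite /binprob e12 -mulrA -exprD -addnn addnK addnn -mul2n exprM.
  by congr (_ * _); rewrite -exprVn; congr (_ ^+ _); field.
have step : m.+1%:R * 'C(m.+1.*2, m.+1)%:R = 2 * m.*2.+1%:R * 'C(m.*2, m)%:R :> R.
  have := mul_bin_diag m.*2.+1 m; rewrite /= => h1.
  rewrite doubleS bin_even_middle -bin_odd_middle -!natrM -mulnA h1.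
  by congr (_%:R); rewrite mulnCA.
set w := binprob _ _ _ in IHm; set w' := binprob _ _ _.
have ww : 2 * m.+1%:R * w' = m.*2.+1%:R * w.
  have e4 : 4 ^+ m != 0 :> R by rewrite expf_neq0 // pnatr_eq0.
  have := congr1 (fun x => x / (2 * 4 ^+ m)) step; rewrite /w /w' !wE exprS => st.
  rewrite [LHS](_ : _ = m.+1%:R * 'C(m.+1.*2, m.+1)%:R / (2 * 4 ^+ m)); last by field.
  by rewrite st; field.
have m0 : 0 <= m%:R :> R by rewrite ler0n.
have d1 : m.*2.+1%:R = 2 * m%:R + 1 :> R by rewrite -natr1 -mul2n natrM.
have d2 : m.+1.*2.+1%:R = 2 * m%:R + 3 :> R.
  by rewrite -natr1 -mul2n natrM -natr1; ring.
have d3 : m.+1%:R = m%:R + 1 :> R by rewrite natr1.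
rewrite d1 d3 in ww; rewrite d1 in IHm; rewrite d2.
have h : 0 < (2 * (m%:R + 1)) ^+ 2 :> R by rewrite exprn_gt0 //; lra.
rewrite -(ler_pM2l h) mulr1.
have -> : (2 * (m%:R + 1)) ^+ 2 * ((2 * m%:R + 3) * w' ^+ 2) =
  (2 * m%:R + 3) * (2 * (m%:R + 1) * w') ^+ 2 by ring.
rewrite ww.
have -> : (2 * m%:R + 3) * ((2 * m%:R + 1) * w) ^+ 2 =
  (2 * m%:R + 3) * (2 * m%:R + 1) * ((2 * m%:R + 1) * w ^+ 2) by ring.
apply: le_trans (ler_wpM2l _ IHm) _; nra.
Qed.

(** The mode is central; the maximum of an odd row 2m+1 equals the central probability of row
    2m+2. *)
Lemma fair_binprob_le n k : n.+1%:R * binprob (1 / 2) n k ^+ 2 <= 1.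
Proof.
have h12 : 0 < (1 / 2 : R) < 1 by lra.
have h12' : 0 <= (1 / 2 : R) <= 1 by lra.
have sq_le x y : 0 <= x -> x <= y -> x ^+ 2 <= y ^+ 2 :> R.
  by move=> x0 xy; rewrite lerXn2r // nnegrE // (le_trans x0).
have [m [->|->]] : exists m, n = m.*2 \/ n = m.*2.+1.
  by exists n./2; have := odd_double_half n; case: odd => /= h; [right|left].
all: have d3 : m.+1%:R = m%:R + 1 :> R by rewrite natr1.
  apply: le_trans (central_binprob_le m); rewrite ler_wpM2l //.
  apply: sq_le; first exact: binprob_ge0.
  apply: binprob_mode => //; first by rewrite -addnn leq_addr.
  have -> : m.*2.+1%:R = 2 * m%:R + 1 :> R by rewrite -natr1 -mul2n natrM.
  by rewrite d3; lra.
apply: le_trans (central_binprob_le m.+1); rewrite doubleS.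
apply: ler_pM => //; first by rewrite exprn_ge0 // binprob_ge0.
  by rewrite ler_nat.
apply: sq_le; first exact: binprob_ge0.
apply: le_trans (_ : binprob (1 / 2) m.*2.+1 m <= _).
  apply: binprob_mode => //; first by rewrite -addnn -addSn leq_addl.
  have -> : m.*2.+2%:R = 2 * m%:R + 2 :> R.
    by rewrite -doubleS -mul2n natrM d3; ring.
  by rewrite d3; lra.
have e12 : 1 - 1 / 2 = 1 / 2 :> R by field.
have m1 : (m <= m.*2.+1)%N by rewrite -addnn leqW ?leq_addr.
rewrite /binprob e12 -!mulrA -!exprD !subnKC //.
by rewrite bin_even_middle natrM [_ ^+ m.*2.+2]exprS; lra.
Qed.

(* A coin of bias q / 2 is a fair coin tossed with probability q; this reduces the
   O(n^(-1/2)) bound on binomial probabilities to the central binomial coefficient. *)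
Lemma binprob_mixture q n k :
  binprob (q / 2) n k = \sum_(j < n.+1) binprob q n j * binprob (1 / 2) j k.
Proof.
have coefL (a b : R) m : ((a%:P + b%:P * 'X) ^+ m)`_k = 'C(m, k)%:R * b ^+ k * a ^+ (m - k).
  rewrite exprDn coef_sum; have E i :
    (a%:P ^+ (m - i) * (b%:P * 'X) ^+ i *+ 'C(m, i))`_k =
      (k == i)%:R * ('C(m, i)%:R * b ^+ i * a ^+ (m - i)).
    rewrite exprMn -!polyC_exp coefMn !coefCM coefXn -mulr_natl.
    by rewrite /=; ring.
  under eq_bigr => i _ do rewrite E.
  have [km|mk] := leqP k m; last first.
    rewrite bin_small // !mul0r big1 // => i _.
    by rewrite gtn_eqF ?mul0r // (leq_trans (ltn_ord i)).
  rewrite (bigD1 (inord k)) //= inordK ?ltnS // eqxx mul1r big1 ?addr0 // => i.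
  rewrite -val_eqE /= inordK ?ltnS // eq_sym => /negPf ->; exact: mul0r.
rewrite /binprob -coefL.
(* Generating functions: the fair coin substitutes 1/2 + X/2 for X in that of bias q. *)
have -> : (1 - q / 2)%:P + (q / 2)%:P * 'X =
    (1 - q)%:P + q%:P * ((1 / 2)%:P + (1 / 2)%:P * 'X) :> {poly R}.
  rewrite mulrDr mulrA -!polyCM addrA -polyCD; congr (_%:P + _%:P * _); field => //.
rewrite exprDn coef_sum; apply: eq_bigr => j _.
rewrite exprMn -!polyC_exp coefMn !coefCM.
have {1}-> : 1 / 2 = 1 - 1 / 2 :> R by field.
by rewrite coefL -mulr_natl; ring.
Qed.

(** The fair bound is of order (j+1)^(-1/2) with j random. It is linearized in 1 / (j+1), whose mean
    under the binomial law is controlled explicitly. *)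
Lemma binprob_half_bound q n k : 0 < q <= 1 ->
  binprob (q / 2) n k <= (q^-1 + 1) / (2 * Num.sqrt n.+1%:R).
Proof.
move=> /andP[q0 q1]; have q01 : 0 <= q <= 1 by rewrite q1 ltW.
set t := Num.sqrt _; have t0 : 0 < t by rewrite sqrtr_gt0 ltr0n.
have t2 : t ^+ 2 = n.+1%:R by rewrite sqr_sqrtr ?ler0n.
(* AM-GM: 2 w <= t w^2 + 1 / t *)
have w_le j : binprob (1 / 2) j k <= (t / j.+1%:R + t^-1) / 2.
  have := fair_binprob_le j k; set w := binprob _ _ _ => jw.
  have w2 : w ^+ 2 <= j.+1%:R^-1 by rewrite -[leRHS]mul1r ler_pdivlMr ?ltr0n // mulrC.
  apply: le_trans (_ : (t * w ^+ 2 + t^-1) / 2 <= _).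
    rewrite ler_pdivlMr // -subr_ge0.
    have -> : t * w ^+ 2 + t^-1 - w * 2 = t^-1 * (t * w - 1) ^+ 2.
      by field; rewrite gt_eqF.
    by rewrite mulr_ge0 ?invr_ge0 ?sqr_ge0 // ltW.
  by rewrite ler_wpM2r ?invr_ge0 // lerD2r ler_wpM2l // ltW.
(* Since C(n, j) / (j+1) = C(n+1, j+1) / (n+1), the sum is, up to the factor 1 / ((n+1) q), the law
   of n + 1 tosses without its index 0. *)
have sum_le : \sum_(j < n.+1) binprob q n j / j.+1%:R <= (n.+1%:R * q)^-1.
  have nq : 0 < n.+1%:R * q by rewrite mulr_gt0 ?ltr0n.
  rewrite -[leRHS]mul1r ler_pdivlMr // mulr_suml -[leRHS](sum_binprob q n.+1).
  rewrite [leRHS]big_ord_recl /= -[leLHS]add0r lerD ?binprob_ge0 //.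
  rewrite le_eqVlt; apply/orP; left; apply/eqP; apply: eq_bigr => j _.
  rewrite /bump /= add1n /binprob subSS exprS.
  have := congr1 (fun m => m%:R : R) (mul_bin_diag n.+1 j); rewrite !natrM /= => h.
  have j0 : j.+1%:R != 0 :> R by rewrite pnatr_eq0.
  apply: (mulfI j0).
  transitivity (n.+1%:R * 'C(n, j)%:R * (q * q ^+ j * (1 - q) ^+ (n - j))).
    by field; rewrite addrC natr1.
  by rewrite h; ring.
rewrite binprob_mixture.
apply: le_trans (_ : \sum_(j < n.+1) binprob q n j * ((t / j.+1%:R + t^-1) / 2) <= _).
  by apply: ler_sum => j _; rewrite ler_wpM2l ?binprob_ge0.
have -> : \sum_(j < n.+1) binprob q n j * ((t / j.+1%:R + t^-1) / 2) =
    t / 2 * (\sum_(j < n.+1) binprob q n j / j.+1%:R) + t^-1 / 2 * \sum_(j < n.+1) binprob q n j.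
  rewrite !mulr_sumr -big_split /=; apply: eq_bigr => j _; ring.
rewrite sum_binprob mulr1.
have -> : (q^-1 + 1) / (2 * t) = t / 2 * (n.+1%:R * q)^-1 + t^-1 / 2.
  by rewrite -t2; field; rewrite !gt_eqF.
by rewrite lerD2r ler_wpM2l // divr_ge0 // ltW.
Qed.

(** Exchanging heads and tails reduces to u <= 1/2, where u = q / 2 with q = 2 u <= 1. *)
Lemma binprob_bound u : 0 < u < 1 ->
  exists2 K, 0 < K & forall n k, binprob u n k <= K / Num.sqrt n.+1%:R.
Proof.
move=> /andP[u0 u1]; wlog u12 : u u0 u1 / u <= 1 / 2.
  move=> W; have [|lt_u] := leP u (1 / 2); first exact: W.
  have [|||K K0 Ku] := W (1 - u); [lra..|].
  exists K => // n k; have [kn|nk] := leqP k n; last first.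
    by rewrite binprob_small // divr_ge0 ?sqrtr_ge0 // ltW.
  apply: le_trans (Ku n (n - k)%N).
  by rewrite /binprob bin_sub // subKn // opprB addrCA subrr addr0 mulrAC.
exists (((2 * u)^-1 + 1) / 2) => [|n k].
  by rewrite divr_gt0 // addr_gt0 // invr_gt0 mulr_gt0.
have uE : 2 * u / 2 = u by field.
have := @binprob_half_bound (2 * u) n k; rewrite uE [(2 * Num.sqrt _)^-1]invfM mulrA.
by apply; apply/andP; split; lra.
Qed.

(** * Growth of sums of products of binomial powers *)

Section BinomialSums.
Variables (e1 e2 : nat) (u v : R).

Definition binsum n : nat :=
  (\sum_(k < n.+1) 'C(n, k) ^ e1 * 'C(n + k, k) ^ e2)%N.

(** Here u is the limit of k / n at the largest term, and v = u / (1 + u) that of k / (n + k), the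
    matching biases for the two binomials. *)
Definition binsum_radius : R := (1 - u) ^+ e1 * (1 - v) ^+ e2.

Hypothesis u01 : 0 < u < 1.
Hypothesis vE : v * (1 + u) = u.
(* Together with [vE], this says that the terms of [binsum] peak at [k = u * n]. *)
Hypothesis uvE : u ^+ e1 * v ^+ e2 = (1 - u) ^+ e1.

Lemma binsum_v01 : 0 < v < 1.
Proof.
case/andP: u01 => u0 u1; have u10 : 0 < 1 + u by lra.
by rewrite -(ltr_pM2r u10) -(ltr_pM2r u10 v) vE mul0r mul1r; lra.
Qed.

Lemma binsum_radius_gt0 : 0 < binsum_radius.
Proof.
by have /andP[v0 v1] := binsum_v01; case/andP: u01 => u0 u1;
  rewrite mulr_gt0 ?exprn_gt0 ?subr_gt0.
Qed.

(** By [uvE] the product of the weights attached to the binomials is the same for all k, namely the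
    n-th power of the radius. *)
Lemma binsum_binprob n : (binsum n)%:R * binsum_radius ^+ n =
  \sum_(k < n.+1) binprob u n k ^+ e1 * binprob v (n + k) k ^+ e2.
Proof.
rewrite natr_sum mulr_suml; apply: eq_bigr => k _.
rewrite natrM !natrX /binsum_radius /binprob addnK !exprMn.
have h : (1 - u) ^+ e1 ^+ n = u ^+ k ^+ e1 * v ^+ k ^+ e2 * (1 - u) ^+ (n - k) ^+ e1.
  rewrite (exprAC u) (exprAC v) (exprAC (1 - u) (n - k)%N) -exprMn uvE -exprD.
  by rewrite subnKC // leq_ord.
by rewrite h (exprAC (1 - v) e2 n); ring.
Qed.

Hypothesis e1_gt0 : (0 < e1)%N.
Hypothesis e12_ge3 : (3 <= e1 + e2)%N.

(** One factor [binprob u n k] is kept and sums to 1. At least two others remain; two of them are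
    bounded by K / sqrt(n+1), the rest by 1. *)
Lemma binsum_upper : exists C, forall n,
  n%:R * (binsum n)%:R * binsum_radius ^+ n <= C.
Proof.
have v01 := binsum_v01.
have [K1 K1_gt0 uK] := binprob_bound u01; have [K2 K2_gt0 vK] := binprob_bound v01.
pose K := Num.max K1 K2; exists (K ^+ 2) => n.
have K_gt0 : 0 < K by rewrite lt_max K1_gt0.
set s := Num.sqrt (n.+1%:R : R); have s_gt0 : 0 < s by rewrite sqrtr_gt0 ltr0n.
have s2 : s ^+ 2 = n.+1%:R by rewrite sqr_sqrtr ?ler0n.
pose w := K / s; have w0 : 0 <= w by rewrite divr_ge0 // ltW.
have u01' : 0 <= u <= 1 by case/andP: u01 => u0 u1; rewrite !ltW.
have v01' : 0 <= v <= 1 by case/andP: v01 => v0 v1; rewrite !ltW.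
have buw k : binprob u n k <= w.
  by apply: le_trans (uK n k) _; rewrite ler_pM2r ?invr_gt0 // le_max lexx.
have bvw k : binprob v (n + k) k <= w.
  apply: le_trans (vK (n + k)%N k) _; apply: ler_pM.
  - exact: ltW.
  - by rewrite invr_ge0 sqrtr_ge0.
  - by rewrite le_max lexx orbT.
  rewrite lef_pV2 ?posrE ?sqrtr_gt0 ?ltr0n // ler_sqrt ?ltr0n // ler_nat.
  by rewrite ltnS leq_addr.
have two_factors i j x y : (2 <= i + j)%N -> 0 <= x <= 1 -> 0 <= y <= 1 ->
    x <= w -> y <= w -> x ^+ i * y ^+ j <= w ^+ 2.
  move=> ij /andP[x0 x1] /andP[y0 y1] xw yw.
  have sq z : 0 <= z -> z <= w -> z ^+ 2 <= w ^+ 2.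
    by move=> z0 zw; rewrite lerXn2r // nnegrE.
  have X m : 0 <= x ^+ m <= 1 by rewrite exprn_ge0 //= exprn_ile1.
  have Y m : 0 <= y ^+ m <= 1 by rewrite exprn_ge0 //= exprn_ile1.
  case: i ij => [|[|i]] ij.
  - rewrite expr0 mul1r; apply: le_trans (sq y y0 yw).
    by rewrite ler_wiXn2l.
  - case: j ij => [//|j] _; rewrite expr1 exprS expr2; apply: ler_pM => //.
      by rewrite mulr_ge0 // exprn_ge0.
    by apply: le_trans yw; rewrite ler_piMr //; case/andP: (Y j).
  - apply: le_trans (sq x x0 xw); rewrite -[leRHS]mulr1.
    have /andP[Y0 Y1] := Y j; apply: ler_pM => //; first by rewrite exprn_ge0.
    by rewrite ler_wiXn2l.
rewrite -mulrA binsum_binprob.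
have -> : K ^+ 2 = n.+1%:R * w ^+ 2.
  by rewrite /w -s2; field; rewrite gt_eqF.
apply: ler_pM; rewrite ?ler0n //.
- apply: sumr_ge0 => k _; rewrite mulr_ge0 ?exprn_ge0 ?binprob_ge0 //.
- by rewrite ler_nat.
rewrite -[leRHS]mulr1 -[X in _ * X](sum_binprob u n) mulr_sumr.
apply: ler_sum => k _; rewrite -(prednK e1_gt0) exprSr mulrAC.
rewrite ler_wpM2r ?binprob_ge0 // two_factors ?binprob_ge0 ?binprob_le1 //.
by rewrite -ltnS -addSn prednK.
Qed.

(** Only the term k = floor((n+1) u) is kept. By [vE] it is a mode of both binomial laws, so each
    factor is at least 1 / (2 (n+1)). *)
Lemma binsum_lower n : (1 / 2) ^+ (e1 + e2) <=
  (binsum n)%:R * binsum_radius ^+ n * n.+1%:R ^+ (e1 + e2).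
Proof.
have v01 := binsum_v01; have /andP[u0 u1] := u01; have /andP[v0 v1] := v01.
have u01' : 0 <= u <= 1 by rewrite !ltW.
have v01' : 0 <= v <= 1 by rewrite !ltW.
have n1 : 0 < n.+1%:R :> R by rewrite ltr0n.
have nu0 : 0 <= n.+1%:R * u by rewrite mulr_ge0 // ltW.
pose k := Num.truncn (n.+1%:R * u).
have /andP[k_le le_k] := truncn_itv nu0; rewrite -/k in k_le le_k.
have k_n : (k < n.+1)%N.
  by rewrite -(ltr_nat R); apply: le_lt_trans k_le _; rewrite gtr_pMr.
have nk : (n + k).+1%:R = n.+1%:R + k%:R :> R by rewrite -natrD addSn.
have k1 : k.+1%:R = k%:R + 1 :> R by rewrite natr1.
have bu : n.+1%:R^-1 <= binprob u n k.
  by apply: binprob_mode_ge => //; rewrite k_le ltW.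
have bv : (2 * n.+1%:R)^-1 <= binprob v (n + k) k.
  apply: le_trans (_ : (n + k).+1%:R^-1 <= _).
    rewrite lef_pV2 ?posrE ?mulr_gt0 // ?ltr0n // -natrM ler_nat mul2n -addnn.
    by rewrite -addSn leq_add2l ltnW.
  apply: binprob_mode_ge => //; first exact: leq_addl.
  rewrite nk k1; rewrite k1 in le_k; apply/andP; split.
    rewrite -(ler_pM2r (_ : 0 < 1 + u)) ?addr_gt0 // -mulrA vE; nra.
  rewrite -(ler_pM2r (_ : 0 < 1 + u)) ?addr_gt0 // -mulrA vE; nra.
rewrite binsum_binprob (bigD1 (Ordinal k_n)) //= mulrDl -[leLHS]addr0 lerD //.
  have -> : (1 / 2 : R) ^+ (e1 + e2) =
      (n.+1%:R^-1 / 2) ^+ e1 * (2 * n.+1%:R)^-1 ^+ e2 * n.+1%:R ^+ (e1 + e2).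
    rewrite [(2 * _)^-1]invfM [2^-1 * _]mulrC -exprD -exprMn; congr (_ ^+ _); field.
    by rewrite addrC natr1 gt_eqF.
  rewrite ler_wpM2r ?exprn_ge0 ?ler0n //.
  have h : 0 <= n.+1%:R^-1 :> R by rewrite invr_ge0 ltW.
  have h' : 0 <= (2 * n.+1%:R)^-1 :> R by rewrite invr_ge0 mulr_ge0 // ltW.
  apply: ler_pM; first by rewrite exprn_ge0 // divr_ge0.
  - by rewrite exprn_ge0.
  - rewrite lerXn2r ?nnegrE ?divr_ge0 ?binprob_ge0 //.
    by apply: le_trans bu; rewrite ler_pdivrMr // ler_peMr // ler1n.
  - by rewrite lerXn2r ?nnegrE ?binprob_ge0.
rewrite mulr_ge0 ?exprn_ge0 //; apply: sumr_ge0 => i _.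
by rewrite mulr_ge0 ?exprn_ge0 ?binprob_ge0.
Qed.

End BinomialSums.

End BinomialDistribution.

(** * Formal and convergent power series *)

Local Notation RR := Rdefinitions.R.

Section FpsDerivation.
Variable R : comNzRingType.
Implicit Types (f g : fps R) (p : {poly R}).

Lemma fps_coefD f g n : fps_coef (f + g) n = fps_coef f n + fps_coef g n.
Proof. by []. Qed.

Lemma fps_coefN f n : fps_coef (- f) n = - fps_coef f n.
Proof. by []. Qed.

Lemma fps_coefM f g n :
  fps_coef (f * g) n = \sum_(i < n.+1) fps_coef f i * fps_coef g (n - i)%N.
Proof. by []. Qed.

Definition fps_deriv f : fps R := FPS (fun n => fps_coef f n.+1 *+ n.+1).

Lemma fps_deriv_poly p : fps_deriv (poly_fps p) = poly_fps p^`().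
Proof. by apply: fpsP => n /=; rewrite coef_deriv. Qed.

Lemma fps_derivM f g :
  fps_deriv (f * g) = fps_deriv f * g + f * fps_deriv g.
Proof.
apply: fpsP => n; have T := @coef_fps_trunc R n.+1.
have -> : fps_coef (fps_deriv (f * g)) n =
    ((fps_trunc n.+2 f * fps_trunc n.+2 g)^`())`_n.
  by rewrite coef_deriv (coef_fps_mul (T f) (T g)).
rewrite derivM coefD.
have T' (h : fps R) i : (i <= n)%N ->
    (fps_trunc n.+2 h)^`()`_i = fps_coef (fps_deriv h) i.
  by move=> le_in; rewrite coef_deriv T.
have Tn (h : fps R) i : (i <= n)%N -> (fps_trunc n.+2 h)`_i = fps_coef h i.
  by move=> le_in; rewrite T // leqW.
by rewrite (coef_fps_mul (T' f) (Tn g)) // (coef_fps_mul (Tn f) (T' g)).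
Qed.

Lemma fps_derivX f n :
  fps_deriv (f ^+ n.+1) = f ^+ n * fps_deriv f *+ n.+1.
Proof.
elim: n => [|n IHn]; first by rewrite expr1 expr0 mul1r.
rewrite exprS fps_derivM {}IHn -mulrnAr mulrA -exprS [fps_deriv f * _]mulrC.
by rewrite mulrnAr -mulrS.
Qed.

End FpsDerivation.

(** * Convergence and evaluation of real power series *)

Section Evaluation.

Implicit Types (f g : fps RR) (x y : RR) (p : {poly RR}).

Definition fps_bounded y f := exists M, forall n, `|fps_coef f n| * y ^+ n <= M.

(** For x >= 0: the radius of convergence exceeds x. The strict inequality makes f analytic at x
    itself. *)
Definition fps_conv x f := exists2 y, x < y & fps_bounded y f.

Definition fps_eval f x : RR := PSeries.PSeries (fps_coef f) x.

Lemma fps_boundedW x y f : 0 <= x -> x <= y -> fps_bounded y f -> fps_bounded x f.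
Proof.
move=> x0 xy [M fM]; exists M => n; apply: le_trans (fM n).
by rewrite ler_wpM2l // lerXn2r // nnegrE // (le_trans x0).
Qed.

Lemma fps_convW x y f : x <= y -> fps_conv y f -> fps_conv x f.
Proof. by move=> xy [z yz fz]; exists z => //; apply: le_lt_trans yz. Qed.

(** Each of the n + 1 powers t^i with i <= n is at least t^n. Products and derivatives of series
    produce a factor n + 1, which this absorbs. *)
Lemma arith_geom_bound (t : RR) n : 0 <= t < 1 -> n.+1%:R * t ^+ n <= (1 - t)^-1.
Proof.
move=> /andP[t0 t1]; rewrite -[leRHS]mul1r ler_pdivlMr ?subr_gt0 //.
have -> : n.+1%:R * t ^+ n * (1 - t) = n.+1%:R * (1 - t) * t ^+ n by ring.
have tn m : 0 <= t ^+ m <= 1 by rewrite exprn_ge0 // exprn_ile1 // ltW.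
have : n.+1%:R * (1 - t) * t ^+ n <= 1 - t ^+ n.+1.
  have -> : 1 - t ^+ n.+1 = (1 - t) * \sum_(i < n.+1) t ^+ i.
    by rewrite -opprB subrX1 -mulNr opprB.
  have -> : n.+1%:R * (1 - t) * t ^+ n = (1 - t) * \sum_(i < n.+1) t ^+ n.
    by rewrite sumr_const card_ord -mulr_natl; ring.
  apply: ler_wpM2l; first by rewrite subr_ge0 ltW.
  apply: ler_sum => i _.
  by apply: ler_wiXn2l => //; [exact: ltW | exact: leq_ord].
have := tn n.+1; lra.
Qed.

Lemma fps_convD x f g : 0 <= x -> fps_conv x f -> fps_conv x g -> fps_conv x (f + g).
Proof.
move=> x0 [y1 xy1 f1] [y2 xy2 g2]; pose y := Num.min y1 y2.
have xy : x < y by rewrite lt_min xy1.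
have y0 := ltW (le_lt_trans x0 xy).
have [|M fM] := fps_boundedW y0 _ f1; first by rewrite ge_min lexx.
have [|N gN] := fps_boundedW y0 _ g2; first by rewrite ge_min lexx orbT.
exists y => //; exists (M + N) => n; apply: le_trans (lerD (fM n) (gN n)).
by rewrite -mulrDl ler_wpM2r ?exprn_ge0 // ler_normD.
Qed.

Lemma fps_convN x f : fps_conv x f -> fps_conv x (- f).
Proof. by move=> [y xy [M fM]]; exists y => //; exists M => n; rewrite /= normrN. Qed.

Lemma fps_convM x f g : 0 <= x -> fps_conv x f -> fps_conv x g -> fps_conv x (f * g).
Proof.
move=> x0 [y1 xy1 f1] [y2 xy2 g2]; pose y := Num.min y1 y2.
have xy : x < y by rewrite lt_min xy1.
have y0 := le_lt_trans x0 xy.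
have [|M fM] := fps_boundedW (ltW y0) _ f1; first by rewrite ge_min lexx.
have [|N gN] := fps_boundedW (ltW y0) _ g2; first by rewrite ge_min lexx orbT.
(* Shrinking y to the midpoint of x and y gives the geometric decay that pays for the n + 1 terms of
   the Cauchy product. *)
pose t := (x + y) / 2 / y; have ty : t * y = (x + y) / 2 by rewrite divfK ?gt_eqF.
have t0 : 0 <= t by rewrite !divr_ge0 // ?addr_ge0 // ltW.
have t1 : t < 1 by rewrite ltr_pdivrMr // mul1r; lra.
have MN : 0 <= M * N.
  rewrite mulr_ge0 //; first by apply: le_trans (fM 0); rewrite mulr1.
  by apply: le_trans (gN 0); rewrite mulr1.
exists (t * y); first by rewrite ty; lra.
exists (M * N * (1 - t)^-1) => n.
have le1 : `|fps_coef (f * g) n| * y ^+ n <= n.+1%:R * (M * N).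
  rewrite fps_coefM (le_trans (ler_wpM2r _ (ler_norm_sum _ _ _))) //.
    by rewrite exprn_ge0 // ltW.
  have -> : n.+1%:R * (M * N) = \sum_(i < n.+1) M * N.
    by rewrite sumr_const card_ord mulr_natl.
  rewrite mulr_suml; apply: ler_sum => i _.
  have -> : `|fps_coef f i * fps_coef g (n - i)| * y ^+ n =
      (`|fps_coef f i| * y ^+ i) * (`|fps_coef g (n - i)| * y ^+ (n - i)).
    have -> : y ^+ n = y ^+ i * y ^+ (n - i) by rewrite -exprD subnKC ?leq_ord.
    by rewrite normrM; ring.
  by rewrite ler_pM // mulr_ge0 // exprn_ge0 // ltW.
have tn : 0 <= t ^+ n by rewrite exprn_ge0.
rewrite exprMn mulrCA; apply: le_trans (ler_wpM2l tn le1) _.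
have -> : t ^+ n * (n.+1%:R * (M * N)) = M * N * (n.+1%:R * t ^+ n) by ring.
by rewrite ler_wpM2l // arith_geom_bound // t0.
Qed.

Lemma fps_conv_deriv x f : 0 <= x -> fps_conv x f -> fps_conv x (fps_deriv f).
Proof.
move=> x0 [y xy [M fM]]; have y0 := le_lt_trans x0 xy.
pose t := (x + y) / 2 / y; have ty : t * y = (x + y) / 2 by rewrite divfK ?gt_eqF.
have t0 : 0 <= t by rewrite !divr_ge0 // ?addr_ge0 // ltW.
have t1 : t < 1 by rewrite ltr_pdivrMr // mul1r; lra.
have M0 : 0 <= M by apply: le_trans (fM 0); rewrite mulr1.
exists (t * y); first by rewrite ty; lra.
exists (M / y * (1 - t)^-1) => n.
rewrite /= normrMn -mulr_natl exprMn.
have -> : n.+1%:R * `|fps_coef f n.+1| * (t ^+ n * y ^+ n) =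
    (`|fps_coef f n.+1| * y ^+ n.+1) / y * (n.+1%:R * t ^+ n).
  by rewrite exprSr; field; rewrite gt_eqF.
apply: ler_pM => //.
- by rewrite divr_ge0 ?mulr_ge0 ?exprn_ge0 // ltW.
- by rewrite mulr_ge0 ?exprn_ge0.
- by rewrite ler_pM2r ?invr_gt0.
- by rewrite arith_geom_bound // t0.
Qed.

Lemma fps_conv_poly x p : 0 <= x -> fps_conv x (poly_fps p).
Proof.
move=> x0; exists (x + 1); first lra.
exists (\sum_(i < size p) `|p`_i| * (x + 1) ^+ i) => n /=.
have le0 i : 0 <= `|p`_i| * (x + 1) ^+ i by rewrite mulr_ge0 // exprn_ge0; lra.
have [lt_n|le_n] := ltnP n (size p).
  by rewrite (bigD1 (Ordinal lt_n)) //= lerDl sumr_ge0.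
by rewrite nth_default // normr0 mul0r sumr_ge0.
Qed.

Lemma fps_convX x f n : 0 <= x -> fps_conv x f -> fps_conv x (f ^+ n).
Proof.
move=> x0 fx; elim: n => [|n IHn]; last by rewrite exprS; apply: fps_convM.
by rewrite expr0 -(rmorph1 (@poly_fps RR)); apply: fps_conv_poly.
Qed.

Lemma fps_conv_radius x f : 0 <= x -> fps_conv x f ->
  Rbar.Rbar_lt (Rbar.Finite (Rbasic_fun.Rabs x)) (PSeries.CV_radius (fps_coef f)).
Proof.
move=> x0 [y xy [M fM]].
apply: (@Rbar.Rbar_lt_le_trans _ (Rbar.Finite y)).
  by rewrite RabsE ger0_norm //=; apply/RltP.
apply: (PSeries.CV_radius_bounded (fps_coef f)).1; exists M => n.
apply/RleP; rewrite RabsE RmultE RpowE normrM normrX [`|y|]ger0_norm //.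
exact: ltW (le_lt_trans x0 xy).
Qed.

Lemma fps_evalM x f g : 0 <= x -> fps_conv x f -> fps_conv x g ->
  fps_eval (f * g) x = fps_eval f x * fps_eval g x.
Proof.
move=> x0 /(fps_conv_radius x0) fx /(fps_conv_radius x0) gx.
rewrite /fps_eval -RmultE -PSeries.PSeries_mult //.
apply: PSeries.PSeries_ext => n; rewrite fps_coefM /PSeries.PS_mult sum_f_R0E.
by rewrite big_mkord.
Qed.

Lemma fps_evalB x f g : 0 <= x -> fps_conv x f -> fps_conv x g ->
  fps_eval (f - g) x = fps_eval f x - fps_eval g x.
Proof.
move=> x0 /(fps_conv_radius x0) fx /(fps_conv_radius x0) gx.
rewrite /fps_eval -RminusE -PSeries.PSeries_minus //.
- exact: PSeries.CV_radius_inside.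
- exact: PSeries.CV_radius_inside.
Qed.

Lemma fps_eval_poly x p : 0 <= x -> fps_eval (poly_fps p) x = p.[x].
Proof.
move=> x0; elim/poly_ind: p => [|p c IHp].
  rewrite horner0 -[RHS](PSeries.PSeries_const_0 x).
  by apply: PSeries.PSeries_ext => n; rewrite /= coef0.
rewrite /fps_eval PSeries.PSeries_decr_1; last first.
  exact/PSeries.CV_radius_inside/(fps_conv_radius x0)/fps_conv_poly.
rewrite hornerMXaddC -IHp RplusE RmultE addrC mulrC.
congr (_ * _ + _); last by rewrite /= coefD coefMX coefC add0r.
apply: PSeries.PSeries_ext => n.
by rewrite /PSeries.PS_decr_1 /= coefD coefMX coefC addr0.
Qed.

Lemma fps_eval1 x : 0 <= x -> fps_eval 1 x = 1.
Proof. by move=> x0; rewrite -(rmorph1 (@poly_fps RR)) fps_eval_poly ?hornerC. Qed.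

Lemma fps_evalX x f n : 0 <= x -> fps_conv x f ->
  fps_eval (f ^+ n) x = fps_eval f x ^+ n.
Proof.
move=> x0 fx; elim: n => [|n IHn]; first by rewrite !expr0 fps_eval1.
by rewrite !exprS fps_evalM ?IHn //; apply: fps_convX.
Qed.

Lemma fps_eval_le x f g : 0 <= x -> fps_conv x g ->
  (forall n, 0 <= fps_coef f n <= fps_coef g n) -> fps_eval f x <= fps_eval g x.
Proof.
move=> x0 /(fps_conv_radius x0) gx fg; apply/RleP/Series.Series_le => [n|].
  have /andP[f0 fgn] := fg n; rewrite RpowE !RmultE.
  by split; apply/RleP; [rewrite mulr_ge0 ?exprn_ge0 | rewrite ler_wpM2r ?exprn_ge0].
exact/Series.ex_series_Rabs/PSeries.CV_disk_inside.
Qed.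

Lemma fps_eval_ge_coef0 x f : 0 <= x -> fps_conv x f ->
  (forall n, 0 <= fps_coef f n) -> fps_coef f 0 <= fps_eval f x.
Proof.
move=> x0 fx f0; rewrite -[leLHS](hornerC _ x) -fps_eval_poly //.
by apply: fps_eval_le => // n /=; rewrite coefC; case: n => [|n]; rewrite ?lexx ?f0.
Qed.

Lemma fps_eval_continuous x f : 0 <= x -> fps_conv x f ->
  forall e, 0 < e -> exists2 d, 0 < d &
    forall y, `|y - x| < d -> `|fps_eval f y - fps_eval f x| < e.
Proof.
move=> x0 /(fps_conv_radius x0)/PSeries.PSeries_continuity fx e /RltP e0.
have [d [/RltP d0 fd]] := fx e e0; exists d => // y yd.
have [->|yx] := eqVneq y x; first by rewrite subrr normr0; apply/RltP.
apply/RltP; rewrite -RdistE; apply: fd; split.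
  by split=> //; apply/eqP; rewrite eq_sym.
by apply/RltP; rewrite /= RdistE.
Qed.

End Evaluation.

(** * Behaviour to the left of the radius *)

Section LeftNeighbourhood.
Variable rho : RR.
Hypothesis rho_gt0 : 0 < rho.
Implicit Types (f g : fps RR) (x y : RR) (p : {poly RR}) (P : RR -> Prop).

Definition left_near P :=
  exists2 d, 0 < d & forall x, 0 <= x -> rho - d < x < rho -> P x.

Lemma left_nearI P1 P2 :
  left_near P1 -> left_near P2 -> left_near (fun x => P1 x /\ P2 x).
Proof.
move=> [d1 d1_gt0 P1d] [d2 d2_gt0 P2d].
exists (Num.min d1 d2) => [|x x0 /andP[dx xr]]; first by rewrite lt_min d1_gt0.
have [le1 le2] : Num.min d1 d2 <= d1 /\ Num.min d1 d2 <= d2.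
  by rewrite !ge_min !lexx orbT.
by split; [apply: P1d | apply: P2d] => //; rewrite xr andbT; lra.
Qed.

Lemma left_nearW P1 P2 :
  (forall x, 0 <= x < rho -> P1 x -> P2 x) -> left_near P1 -> left_near P2.
Proof.
move=> P12 [d d0 P1d]; exists d => // x x0 dx; apply: P12; last exact: P1d.
by rewrite x0; case/andP: dx.
Qed.

Lemma left_near_lt e : 0 < e -> left_near (fun x => rho - x < e).
Proof. by move=> e0; exists e => // x _ /andP[xe _]; lra. Qed.

Lemma left_near_ex P : left_near P -> exists x, 0 <= x < rho /\ P x.
Proof.
move=> [d d0 Pd]; pose x := Num.max 0 (rho - d / 2).
have x0 : 0 <= x by rewrite le_max lexx.
have xr : x < rho by rewrite gt_max rho_gt0; lra.
exists x; rewrite x0 xr; split=> //; apply: Pd => //; rewrite xr andbT.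
have : rho - d / 2 <= x by rewrite le_max lexx orbT.
lra.
Qed.

Lemma fps_eval_near f e : fps_conv rho f -> 0 < e ->
  left_near (fun x => `|fps_eval f x - fps_eval f rho| < e).
Proof.
move=> fr e0; have [d d0 fd] := fps_eval_continuous (ltW rho_gt0) fr e0.
exists d => // x _ /andP[dx xr]; apply: fd.
by rewrite ler0_norm; lra.
Qed.

Lemma fps_eval_bounded f : fps_conv rho f ->
  exists2 M, 0 < M & left_near (fun x => `|fps_eval f x| <= M).
Proof.
move=> fr; exists (`|fps_eval f rho| + 1); first by rewrite ltr_wpDl.
apply: left_nearW (fps_eval_near fr ltr01) => x _ fx.
rewrite -[fps_eval f x](subrK (fps_eval f rho)) addrC.
by apply: le_trans (ler_normD _ _) _; rewrite lerD2l ltW.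
Qed.

Lemma fps_eval_away f : fps_conv rho f -> fps_eval f rho != 0 ->
  exists2 e, 0 < e & left_near (fun x => e <= `|fps_eval f x|).
Proof.
move=> fr f0; exists (`|fps_eval f rho| / 2).
  by rewrite divr_gt0 // normr_gt0.
have e0 : 0 < `|fps_eval f rho| / 2 by rewrite divr_gt0 // normr_gt0.
apply: left_nearW (fps_eval_near fr e0) => x _.
have := lerB_normD (fps_eval f x) (fps_eval f rho - fps_eval f x).
have := ler_normD (fps_eval f x) (fps_eval f rho - fps_eval f x).
rewrite (distrC (fps_eval f x)) [_ + (_ - _)]addrC subrK; lra.
Qed.

Lemma fps_eval_eq0 f C : fps_conv rho f ->
  left_near (fun x => `|fps_eval f x| <= C * (rho - x)) -> fps_eval f rho = 0.
Proof.
move=> fr fC; apply/eqP; apply: contraT => f0; have [e e0 fe] := fps_eval_away fr f0.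
have M0 : 0 < `|C| + 1 by rewrite ltr_wpDl.
have eM : 0 < e / (`|C| + 1) by rewrite divr_gt0.
have [x [/andP[x0 xr] [[f1 f2] f3]]] :=
  left_near_ex (left_nearI (left_nearI fC fe) (left_near_lt eM)).
have := le_trans f2 f1; rewrite leNgt => /negP[].
move: f3; rewrite ltr_pdivlMr // => f3; apply: le_lt_trans f3.
rewrite mulrC ler_wpM2l //; first lra.
by have := ler_norm C; lra.
Qed.

Lemma fps_eval_le_left f K : fps_conv rho f ->
  left_near (fun x => fps_eval f x <= K) -> fps_eval f rho <= K.
Proof.
move=> fr fK; rewrite leNgt; apply/negP => Kf.
have e0 : 0 < fps_eval f rho - K by lra.
have [x [_ [f1 f2]]] := left_near_ex (left_nearI fK (fps_eval_near fr e0)).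
move: f2; rewrite ltr_norml => /andP[f2 _]; lra.
Qed.

End LeftNeighbourhood.

Lemma fps_coefXM (R : comNzRingType) (f : fps R) n :
  fps_coef (poly_fps 'X * f) n = if n is n'.+1 then fps_coef f n' else 0.
Proof.
rewrite fps_coefM big_ord_recl /= coefX mul0r add0r.
case: n => [|n]; first by rewrite big_ord0.
rewrite big_ord_recl /= coefX mul1r subSS subn0 big1 ?addr0 // => i _.
by rewrite coefX mul0r.
Qed.

(** The extra factor f avoids the exponent j - 1. *)
Lemma fps_deriv_pow (R : comNzRingType) (f : fps R) j :
  f * fps_deriv (f ^+ j) = j%:R * fps_deriv f * f ^+ j.
Proof.
case: j => [|j]; last by rewrite fps_derivX exprS -mulr_natl; ring.
rewrite expr0 -(rmorph1 (@poly_fps R)) fps_deriv_poly derivC rmorph0.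
by rewrite mulr0 !mul0r.
Qed.

(** Differentiate D^j F^(j) = E_j F and multiply by D. With S the series converging beyond rho, all
    E_j are analytic at rho even though F is not known to be. *)
Lemma fps_deriv_higher (R : comNzRingType) (D E F : fps R) (S : fps R -> Prop) :
    (forall f, S f -> S (fps_deriv f)) ->
    (forall f g, S f -> S g -> S (f - g)) ->
    (forall f g, S f -> S g -> S (f * g)) -> S 1 ->
    S D -> S E -> D * fps_deriv F = E * F ->
  forall j, exists2 Ej, S Ej & D ^+ j * iter j (@fps_deriv R) F = Ej * F.
Proof.
move=> Sd SB SM S1 SD SE DE; have S0 : S 0 by rewrite -(subrr 1); apply: SB.
have Snat n : S n%:R.
  elim: n => [//|n IHn].
  have -> : n.+1%:R = n%:R - (0 - 1) :> fps R by rewrite sub0r opprK natr1.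
  by apply: (SB) => //; apply: SB.
elim=> [|j [Ej SEj IHj]]; first by exists 1; rewrite ?mul1r.
exists (Ej * E - (j%:R * fps_deriv D * Ej - D * fps_deriv Ej)).
  by apply: (SB); [|apply: (SB)]; apply: (SM); auto.
have := congr1 (fun f => D * fps_deriv f) IHj.
rewrite !fps_derivM mulrDr mulrA fps_deriv_pow => DFj.
have -> : D ^+ j.+1 * iter j.+1 (@fps_deriv R) F =
  D * (D ^+ j * fps_deriv (iter j (@fps_deriv R) F)) by rewrite exprS iterS mulrA.
rewrite -[LHS](addKr (j%:R * fps_deriv D * D ^+ j * iter j (@fps_deriv R) F)).
rewrite DFj -[X in - X]mulrA IHj.
have -> : D * (fps_deriv Ej * F + Ej * fps_deriv F) =
  D * fps_deriv Ej * F + Ej * (D * fps_deriv F) by ring.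
by rewrite DE; ring.
Qed.

(* The logarithmic derivative of the relation, cleared of denominators. *)
Lemma fps_relation_ode (R : comNzRingType) (F U V T : fps R) a k :
    fps_deriv T = 1 -> F ^+ a.+1 * U * T ^+ k.+1 = V ->
  a.+1%:R * U * V * T * fps_deriv F =
  (fps_deriv V * U * T - V * fps_deriv U * T - k.+1%:R * U * V) * F.
Proof.
move=> dT <-; rewrite !fps_derivM !fps_derivX dT.
rewrite -(mulr_natl (F ^+ a * _)) -(mulr_natl (T ^+ k * _)) exprS [T ^+ _]exprS.
move: (F ^+ a) (T ^+ k) (fps_deriv F) (fps_deriv U) (a.+1%:R) (k.+1%:R).
move=> A B F' U' a' k'; ring.
Qed.

(** Without the factor T the coefficient of F' does not vanish at rho when U and V do not. *)
Lemma fps_relation_ode0 (R : comNzRingType) (F U V : fps R) a :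
    F ^+ a.+1 * U = V ->
  a.+1%:R * U * V * fps_deriv F = (fps_deriv V * U - V * fps_deriv U) * F.
Proof.
move=> <-; rewrite !fps_derivM !fps_derivX -(mulr_natl (F ^+ a * _)) exprS.
move: (F ^+ a) (fps_deriv F) (fps_deriv U) (a.+1%:R) => A F' U' a'; ring.
Qed.

(** * Singularity at the radius of convergence *)

Section Singularity.
Variables (rho : RR) (F : fps RR).
Hypothesis rho_gt0 : 0 < rho.
Hypothesis F_coef0 : fps_coef F 0 = 1.
Hypothesis F_ge0 : forall n, 0 <= fps_coef F n.
Variable C : RR.
Hypothesis F_upper : forall n, n%:R * fps_coef F n * rho ^+ n <= C.
Variables (N : nat) (c : RR).
Hypothesis c_gt0 : 0 < c.
Hypothesis F_lower : forall n, c <= fps_coef F n * rho ^+ n * n.+1%:R ^+ N.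

Lemma singular_conv x : 0 <= x < rho -> fps_conv x F.
Proof.
(* The summand 1 covers index 0, where [F_upper] only gives 0 <= C. *)
move=> /andP[x0 xr]; exists rho => //; exists (1 + C) => n.
rewrite ger0_norm //; case: n => [|n].
  by rewrite F_coef0 mulr1 lerDl; apply: le_trans (F_upper 0); rewrite !mul0r.
apply: le_trans (_ : C <= _); last by rewrite lerDr.
apply: le_trans (F_upper n.+1); rewrite -mulrA ler_peMl ?ler1n //.
by rewrite mulr_ge0 // exprn_ge0 // ltW.
Qed.

Lemma singular_ge1 x : 0 <= x < rho -> 1 <= fps_eval F x.
Proof.
move=> xr; rewrite -F_coef0; apply: fps_eval_ge_coef0 => //.
  by case/andP: xr.
exact: singular_conv.
Qed.

(** The series F' is dominated coefficientwise by that of C / (rho - z). *)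
Lemma singular_deriv_bound x : 0 <= x < rho ->
  fps_eval (fps_deriv F) x * (rho - x) <= C.
Proof.
move=> /andP[x0 xr]; rewrite -ler_pdivlMr ?subr_gt0 //.
pose G : fps RR := FPS (fun n => C / rho ^+ n.+1).
have rho0 : rho != 0 by rewrite gt_eqF.
have Gx : fps_conv x G.
  exists rho => //; exists (`|C| / rho) => n; rewrite /= normrM normfV normrX.
  rewrite (ger0_norm (ltW rho_gt0)) exprSr; rewrite le_eqVlt; apply/orP; left.
  by apply/eqP; field; rewrite rho0 expf_neq0.
have TG : poly_fps (rho%:P - 'X) * G = poly_fps C%:P.
  apply: fpsP => n; rewrite rmorphB mulrBl.
  rewrite fps_coefD fps_coefN fps_coefXM fps_coefM big_ord_recl /= !coefC subn0.
  rewrite big1 ?addr0 => [|i _]; last by rewrite coefC mul0r.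
  case: n => [|n] /=; first by rewrite expr1 subr0; field.
  by rewrite exprS; field; rewrite expf_neq0 ?rho0.
have : fps_eval (poly_fps (rho%:P - 'X) * G) x = C.
  by rewrite TG fps_eval_poly // hornerC.
rewrite fps_evalM ?fps_eval_poly // ?hornerE; last exact: fps_conv_poly.
move=> GE; have -> : C / (rho - x) = fps_eval G x.
  by rewrite -GE mulrC mulKf // subr_eq0 gt_eqF.
apply: fps_eval_le => // n; rewrite /= mulrn_wge0 //=.
by rewrite ler_pdivlMr ?exprn_gt0 // -mulr_natl F_upper.
Qed.

(** The factor produced by j derivations is (n+1)...(n+j), at least (n+1)^j. *)
Lemma singular_deriv_coef j n :
  fps_coef F (n + j) * n.+1%:R ^+ j <= fps_coef (iter j (@fps_deriv RR) F) n.
Proof.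
elim: j n => [|j IHj] n; first by rewrite addn0 mulr1.
rewrite iterS /= -[leRHS]mulr_natr addnS -addSn exprSr mulrA ler_pM2r ?ltr0n //.
apply: le_trans (IHj n.+1); rewrite ler_wpM2l // lerXn2r ?nnegrE ?ler0n //.
by rewrite ler_nat.
Qed.

(** After N derivations the coefficients times rho^n are at least d > 0. A partial sum of m terms is
    continuous at rho and at least m d there, so any bound K would exceed every m d. *)
Lemma singular_deriv_unbounded K :
  ~ left_near rho (fun x => fps_eval (iter N (@fps_deriv RR) F) x <= K).
Proof.
(* The constant comes from n + N + 1 <= (n + 1)(N + 1). *)
pose FN := iter N (@fps_deriv RR) F; pose d := c / (N.+1%:R * rho) ^+ N => FNK.
have d_gt0 : 0 < d by rewrite divr_gt0 // exprn_gt0 // mulr_gt0 // ltr0n.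
have FN_ge0 n : 0 <= fps_coef FN n.
  by apply: le_trans (singular_deriv_coef N n); rewrite mulr_ge0 // exprn_ge0.
have FN_lower n : d <= fps_coef FN n * rho ^+ n.
  rewrite ler_pdivrMr; last by rewrite exprn_gt0 // mulr_gt0 // ltr0n.
  apply: le_trans (F_lower (n + N)) _.
  have le1 : (n + N).+1%:R ^+ N <= (n.+1%:R * N.+1%:R) ^+ N :> RR.
    rewrite -natrM lerXn2r ?nnegrE ?ler0n // ler_nat.
    by rewrite mulSn mulnS addnA (addnC N.+1) addnS leq_addr.
  apply: le_trans (ler_wpM2l _ le1) _.
    by rewrite mulr_ge0 // exprn_ge0 // ltW.
  have -> : fps_coef F (n + N) * rho ^+ (n + N) * (n.+1%:R * N.+1%:R) ^+ N =
    (fps_coef F (n + N) * n.+1%:R ^+ N) * (rho ^+ n * (N.+1%:R * rho) ^+ N).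
    by rewrite exprD !exprMn; ring.
  rewrite -[leRHS]mulrA ler_wpM2r ?singular_deriv_coef //.
  by rewrite mulr_ge0 ?exprn_ge0 ?mulr_ge0 // ltW.
have FNx x : 0 <= x < rho -> fps_conv x FN.
  move=> xr; have x0 : 0 <= x by case/andP: xr.
  rewrite /FN; elim: {FN FNK FN_ge0 FN_lower d d_gt0} N => [|j IHj].
    exact: singular_conv.
  by rewrite iterS; apply: fps_conv_deriv.
have part m : m%:R * d <= K.
  pose p := fps_trunc m FN.
  have : fps_eval (poly_fps p) rho <= K.
    apply: fps_eval_le_left => //; first exact/fps_conv_poly/ltW.
    apply: left_nearW FNK => x xr; have x0 : 0 <= x by case/andP: xr.
    apply: le_trans; apply: fps_eval_le => // [|n]; first exact: FNx.
    by rewrite /= coef_poly; case: ifP; rewrite ?lexx ?FN_ge0.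
  rewrite fps_eval_poly ?horner_poly; last exact: ltW.
  apply: le_trans; rewrite mulr_natl -{1}[m]card_ord -sumr_const.
  by apply: ler_sum => i _; apply: FN_lower.
have := archi_boundP (_ : 0 <= K / d); set m := Num.bound _ => mK.
have K0 : 0 <= K by rewrite (le_trans _ (part 0)) // mul0r.
have := mK (divr_ge0 K0 (ltW d_gt0)); rewrite ltr_pdivrMr // ltNge => /negP[].
exact: part.
Qed.

Lemma singular_relation_false a k (U V : fps RR) :
    fps_conv rho U -> fps_conv rho V ->
    fps_eval U rho != 0 -> fps_eval V rho != 0 ->
  F ^+ a.+1 * U * poly_fps ('X - rho%:P) ^+ k <> V.
Proof.
move=> rU rV U0 V0; have r0 := ltW rho_gt0.
set T := poly_fps _ => FUV.
have evT x : 0 <= x -> fps_eval T x = x - rho.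
  by move=> x0; rewrite fps_eval_poly // !hornerE.
have rT x : 0 <= x -> fps_conv x T by move=> x0; apply: fps_conv_poly.
have dT : fps_deriv T = 1.
  by rewrite fps_deriv_poly derivXsubC rmorph1.
have rnat x n : 0 <= x -> fps_conv x (n%:R : fps RR).
  by move=> x0; rewrite -(rmorph_nat (@poly_fps RR)); apply: fps_conv_poly.
have ev_nat x n : 0 <= x -> fps_eval (n%:R : fps RR) x = n%:R.
  by move=> x0; rewrite -(rmorph_nat (@poly_fps RR)) fps_eval_poly // -polyC_natr hornerC.
have rN n := rnat rho n r0.
have conv_lt f x : fps_conv rho f -> 0 <= x < rho -> fps_conv x f.
  by move=> rf /andP[_ /ltW xr]; apply: fps_convW rf.
have cB f g : fps_conv rho f -> fps_conv rho g -> fps_conv rho (f - g).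
  by move=> rf rg; apply: fps_convD => //; apply: fps_convN.
have cM f g : fps_conv rho f -> fps_conv rho g -> fps_conv rho (f * g).
  exact: fps_convM.
have cd f : fps_conv rho f -> fps_conv rho (fps_deriv f).
  exact: fps_conv_deriv.
case: k FUV => [|k] FUV.
  (* No pole: F is bounded since F^(a+1) = V / U and F >= 1, and D(rho) <> 0 then bounds the N-th
     derivative. *)
  rewrite expr0 mulr1 in FUV; have DE := fps_relation_ode0 FUV.
  have [eU eU0 Une] := fps_eval_away rho_gt0 rU U0.
  have [MV MV0 VM] := fps_eval_bounded rho_gt0 rV.
  have FM : left_near rho (fun x => fps_eval F x <= MV / eU).
    apply: left_nearW (left_nearI Une VM) => x xr [Ux Vx].
    have x0 : 0 <= x by case/andP: xr.
    have F1 := singular_ge1 xr.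
    apply: le_trans (ler_eXnr (ltn0Sn a) F1) _.
    rewrite ler_pdivlMr //; apply: le_trans Vx; rewrite -FUV.
    rewrite fps_evalM ?fps_evalX //; first last.
    - exact: conv_lt.
    - by apply: fps_convX => //; apply: singular_conv.
    - exact: singular_conv.
    rewrite normrM ger0_norm; last by rewrite exprn_ge0 // (le_trans ler01).
    by rewrite ler_wpM2l // exprn_ge0 // (le_trans ler01).
  set D := _ * V in DE; set E := _ - _ in DE.
  have rD : fps_conv rho D by rewrite /D; auto.
  have rE : fps_conv rho E by rewrite /E; auto.
  have D0 : fps_eval D rho != 0.
    rewrite !fps_evalM // ?ev_nat //; last by auto.
    by rewrite !mulf_neq0 // pnatr_eq0.
  have [EN rEN DEN] := fps_deriv_higher cd cB cM (rN 1) rD rE DE N.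
  have rDN : fps_conv rho (D ^+ N) by apply: fps_convX.
  have [|eD eD0 Dne] := fps_eval_away rho_gt0 rDN.
    by rewrite fps_evalX // expf_neq0.
  have [ME ME0 EM] := fps_eval_bounded rho_gt0 rEN.
  apply: (@singular_deriv_unbounded (ME * (MV / eU) / eD)).
  apply: left_nearW (left_nearI FM (left_nearI Dne EM)) => x xr [Fx [Dx Ex]].
  have x0 : 0 <= x by case/andP: xr.
  have F1 := singular_ge1 xr.
  have FNx : fps_conv x (iter N (@fps_deriv RR) F).
    elim: {DEN rDN eD eD0 Dne Dx} N => [|j IHj]; first exact: singular_conv.
    by rewrite iterS; apply: fps_conv_deriv.
  have := congr1 (fun f => `|fps_eval f x|) DEN.
  rewrite /= !fps_evalM //; do ?[exact: singular_conv | exact: conv_lt].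
  rewrite !normrM => DENx; rewrite ler_pdivlMr // mulrC.
  apply: le_trans (_ : eD * `|fps_eval (iter N (@fps_deriv RR) F) x| <= _).
    by rewrite ler_wpM2l ?ler_norm // ltW.
  apply: le_trans (ler_wpM2r _ Dx) _ => //; rewrite DENx.
  by rewrite ler_pM // ger0_norm // (le_trans ler01).
(* A pole: at rho the coefficient W of F is -(k+1) U V, nonzero, while T F' is bounded by C; so F is
   bounded. *)
have := fps_relation_ode dT FUV.
set D := _ * T * _; set W := _ - _ => DW.
have rW : fps_conv rho W.
  by rewrite /W; auto 10.
have W0 : fps_eval W rho != 0.
  rewrite /W !fps_evalB // ?fps_evalM ?evT ?ev_nat ?subrr ?mulr0 ?sub0r ?oppr_eq0 ?subr0 //.
  all: auto 10.
  by rewrite oppr0 sub0r oppr_eq0 !mulf_neq0 // pnatr_eq0.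
have [eW eW0 Wne] := fps_eval_away rho_gt0 rW W0.
have rUV : fps_conv rho (a.+1%:R * U * V) by auto.
have [MD MD0 DM] := fps_eval_bounded rho_gt0 rUV.
pose K := MD * C / eW.
have FK : left_near rho (fun x => fps_eval F x <= K).
  apply: left_nearW (left_nearI Wne DM) => x xr [Wx Dx].
  have /andP[x0 xr'] := xr; have F1 := singular_ge1 xr.
  have hF := singular_conv xr; have hF' := fps_conv_deriv x0 hF.
  have F'0 : 0 <= fps_eval (fps_deriv F) x.
    by apply: le_trans (fps_eval_ge_coef0 x0 hF' _) => [|n]; rewrite /= mulrn_wge0.
  have hUV := conv_lt _ _ rUV xr; have hT := rT x x0; have hW := conv_lt _ _ rW xr.
  have := congr1 (fun f => `|fps_eval f x|) DW.
  rewrite /D /= (fps_evalM x0 (fps_convM x0 hUV hT) hF') (fps_evalM x0 hUV hT).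
  rewrite (fps_evalM x0 hW hF) evT //.
  have nx : `|x - rho| = rho - x by rewrite distrC ger0_norm // subr_ge0 ltW.
  rewrite [LHS]normrM [X in X * _]normrM [RHS]normrM (ger0_norm F'0) nx => DWx.
  rewrite ler_pdivlMr // mulrC.
  apply: le_trans (ler_wpM2r _ Wx) _; first exact: le_trans F1.
  rewrite -[X in _ * X <= _]ger0_norm; last exact: le_trans F1.
  rewrite -DWx -mulrA; apply: ler_pM => //.
    by rewrite mulr_ge0 // subr_ge0 ltW.
  by rewrite mulrC singular_deriv_bound.
have K0 : 0 <= K.
  have [x [xr Fx]] := left_near_ex rho_gt0 FK.
  by apply: le_trans Fx; apply: le_trans (singular_ge1 xr).
have [MU MU0 UM] := fps_eval_bounded rho_gt0 rU.
(* With F bounded, V = F^(a+1) U T^(k+1) is O(rho - x), hence vanishes at rho. *)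
case/eqP: V0; apply: (@fps_eval_eq0 rho rho_gt0 V (K ^+ a.+1 * MU)) => //.
have lt1 := left_near_lt rho ltr01.
apply: left_nearW (left_nearI FK (left_nearI UM lt1)) => x xr [Fx [Ux x1]].
have /andP[x0 xr'] := xr; have F1 := singular_ge1 xr.
have Fx' := singular_conv xr.
have hU := conv_lt _ _ rU xr; have hT := rT x x0.
have hFX := fps_convX a.+1 x0 Fx'; have hTX := fps_convX k.+1 x0 hT.
rewrite -FUV (fps_evalM x0 (fps_convM x0 hFX hU) hTX) (fps_evalM x0 hFX hU).
rewrite !fps_evalX // evT // !normrM !normrX ger0_norm; last exact: le_trans F1.
have rx : 0 <= rho - x by rewrite subr_ge0 ltW.
rewrite (distrC x) (ger0_norm rx).
apply: ler_pM => //; rewrite ?mulr_ge0 ?exprn_ge0 //; first exact: le_trans F1.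
  apply: ler_pM => //; first by rewrite exprn_ge0 // (le_trans _ F1).
  by rewrite lerXn2r // nnegrE // (le_trans _ F1).
by rewrite exprS ler_piMr // exprn_ile1 // ltW.
Qed.

(** The powers of X - rho are split off P and Q. If P has the larger one, F^(a+1) would tend to 0,
    against F >= 1; otherwise the previous lemma applies. *)
Lemma singular_rational_relation_false a (G H : fps RR) (P Q : {poly RR}) :
    fps_conv rho G -> fps_conv rho H ->
    fps_eval G rho != 0 -> fps_eval H rho != 0 -> P != 0 -> Q != 0 ->
  F ^+ a.+1 * G * poly_fps Q <> H * poly_fps P.
Proof.
move=> rG rH G0 H0 P0 Q0.
have [s [P1]] := multiplicity_XsubC P rho; rewrite P0 /= => P1r ->.
have [t [Q1]] := multiplicity_XsubC Q rho; rewrite Q0 /= => Q1r ->.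
have r0 := ltW rho_gt0; have rP p : fps_conv rho (poly_fps p) by apply: fps_conv_poly.
have rU : fps_conv rho (G * poly_fps Q1) by apply: fps_convM.
have rV : fps_conv rho (H * poly_fps P1) by apply: fps_convM.
have U0 : fps_eval (G * poly_fps Q1) rho != 0.
  by rewrite fps_evalM // mulf_neq0 // fps_eval_poly.
have V0 : fps_eval (H * poly_fps P1) rho != 0.
  by rewrite fps_evalM // mulf_neq0 // fps_eval_poly.
rewrite !rmorphM !rmorphXn /=; set T := poly_fps ('X - _).
have T0 : T != 0.
  by rewrite -(rmorph0 (@poly_fps RR)) (inj_eq (@poly_fps_inj _)) polyXsubC_eq0.
rewrite !mulrA -(mulrA _ G).
have [le_st|/ltnW le_ts] := leqP s t => FUV.
  apply: (@singular_relation_false a (t - s) _ _ rU rV U0 V0).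
  apply: (mulIf (expf_neq0 s T0)); rewrite -FUV -[in RHS](subnK le_st) exprD.
  by rewrite -[LHS]mulrA.
have [s_t|lt_ts] := leqP s t.
  apply: (@singular_relation_false a 0 _ _ rU rV U0 V0).
  have /eqP st : s == t by rewrite eqn_leq s_t le_ts.
  by apply: (mulIf (expf_neq0 s T0)); rewrite expr0 mulr1 {1}st.
have FUV' : F ^+ a.+1 * (G * poly_fps Q1) = H * poly_fps P1 * T ^+ (s - t).
  apply: (mulIf (expf_neq0 t T0)); rewrite FUV -[in LHS](subnK le_ts) exprD.
  by rewrite mulrA.
case/eqP: U0.
have [M M0 VM] := fps_eval_bounded rho_gt0 rV.
apply: (@fps_eval_eq0 rho rho_gt0 _ M) => //.
apply: left_nearW (left_nearI VM (left_near_lt rho ltr01)) => x xr [Vx x1].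
have /andP[x0 xr'] := xr; have F1 := singular_ge1 xr.
have cU := fps_convW (ltW xr') rU; have cV := fps_convW (ltW xr') rV.
have cT : fps_conv x T by apply: fps_conv_poly.
have cF := singular_conv xr.
have := congr1 (fun f => `|fps_eval f x|) FUV'.
rewrite /= (fps_evalM x0 (fps_convX _ x0 cF) cU).
rewrite (fps_evalM x0 cV (fps_convX _ x0 cT)) !fps_evalX //.
rewrite [fps_eval T x]fps_eval_poly // !hornerE [LHS]normrM [RHS]normrM.
rewrite !normrX (distrC x).
have rx : 0 <= rho - x by rewrite subr_ge0 ltW.
rewrite (ger0_norm rx) (ger0_norm (le_trans ler01 F1)) => FUx.
apply: le_trans (_ : fps_eval F x ^+ a.+1 * `|fps_eval (G * poly_fps Q1) x| <= _).
  by rewrite ler_peMl // exprn_ege1.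
rewrite FUx; apply: ler_pM => //; first by rewrite exprn_ge0.
rewrite -subn_gt0 in lt_ts; rewrite -(prednK lt_ts) exprS ler_piMr //.
by rewrite exprn_ile1 // ltW.
Qed.

End Singularity.

(** * Reduction to multiplicative relations *)

Lemma ratfun_clear_denominators (K : fieldType) n (q : 'I_n -> {fraction {poly K}})
    (h : 'I_n -> fps K) :
    (exists s, q s != 0) ->
    \sum_s ratfun_laurent (q s) * FracField.tofrac (h s) = 0 ->
  exists2 c : 'I_n -> {poly K}, exists s, c s != 0 & \sum_s poly_fps (c s) * h s = 0.
Proof.
move=> [s0 qs0] rel; pose d s := \d_(repr (q s)).
have d0 s : d s != 0 by apply: denom_ratioP.
pose c s := \n_(repr (q s)) * \prod_(t | t != s) d t.
exists c.
  exists s0; rewrite mulf_neq0 //; last by apply/prodf_neq0.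
  by apply: contraNneq qs0 => n0; rewrite (fracE (q s0)) n0 tofrac0 mul0r.
apply/eqP; rewrite -tofrac_eq0 rmorph_sum /=.
have mul_divK (F : fieldType) (x y z w : F) : z != 0 -> x * y * w = z * y * (x / z * w).
  by move=> z0; field.
have cE s : FracField.tofrac (poly_fps (c s) * h s) =
    FracField.tofrac (poly_fps (\prod_t d t)) * (ratfun_laurent (q s) * FracField.tofrac (h s)).
  have ds : FracField.tofrac (poly_fps (d s) : fps K) != 0 by rewrite poly_fps_frac_eq0.
  rewrite /ratfun_laurent -/(d s) (bigD1 s) //= /c !(rmorphM, tofracM) /=.
  exact: mul_divK.
by under eq_bigr => s _ do rewrite cE; rewrite -mulr_sumr rel mulr0.
Qed.

Section Criterion.
Variables (m : nat) (a : 'I_m -> nat -> nat).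
Hypothesis a0 : forall i, a i 0%N = 1%N.

Definition fps_monomial (K : comNzRingType) (mu : 'X_{1..m}) : fps K :=
  \prod_i nat_fps K (a i) ^+ mu i.

Lemma fps_map_monomial (K : comNzRingType) mu :
  fps_map intr (fps_monomial int mu) = fps_monomial K mu.
Proof.
rewrite /fps_monomial rmorph_prod; apply: eq_bigr => i _.
by rewrite rmorphXn /= fps_map_nat.
Qed.

Lemma nat_fps_neq0 (K : comNzRingType) i : nat_fps K (a i) != 0.
Proof.
apply/eqP => /(congr1 (fun f => fps_coef f 0)) /=; rewrite a0 => /eqP.
by rewrite oner_eq0.
Qed.

Lemma fps_monomial_neq0 (K : idomainType) mu : fps_monomial K mu != 0.
Proof. by apply/prodf_neq0 => i _; rewrite expf_neq0 ?nat_fps_neq0. Qed.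

Hypothesis a_lucas : forall p, prime p -> forall i, lucas_seq p (a i).

Definition lucas_factor p (mu : 'X_{1..m}) : {poly 'F_p} :=
  \prod_i (\poly_(j < p) (a i j)%:R) ^+ mu i.

Lemma fps_monomial_lucas p mu : prime p ->
  fps_monomial 'F_p mu = poly_fps (lucas_factor p mu) * fps_monomial 'F_p mu ^+ p.
Proof.
move=> pp; rewrite /fps_monomial /lucas_factor rmorph_prod /= -prodrXl -big_split /=.
apply: eq_bigr => i _; rewrite rmorphXn /= exprAC -exprMn; congr (_ ^+ _).
by apply: lucas_fps => //; apply: a_lucas.
Qed.

Lemma size_lucas_factor p mu : prime p ->
  (size (lucas_factor p mu) <= (mdeg mu * p.-1).+1)%N.
Proof.
move=> pp; rewrite mdegE big_distrl /=.
apply: (big_rec2 (fun (q : {poly 'F_p}) n => (size q <= n.+1)%N)) => [|i n q _ qn].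
  by rewrite size_poly1.
apply: leq_trans (size_polyMleq _ _) _; set A := \poly_(j < p) _.
have sA : (size (A ^+ mu i) <= (mu i * p.-1).+1)%N.
  apply: leq_trans (size_poly_exp_leq _ _) _; rewrite ltnS mulnC leq_mul2l.
  have := size_poly p (fun j => (a i j)%:R : 'F_p); rewrite -/A.
  by case: (size A) => [|s] /= sp; rewrite ?leq0n ?orbT // -ltnS prednK ?sp ?orbT ?prime_gt0.
by move: (size _) (size _) (mu i * p.-1)%N sA qn => x y z; lia.
Qed.

(** Indexed by [bool] so that a two-term relation is an instance of [fps_dependent]. *)
Definition monomial_pair (mu nu : 'X_{1..m}) (b : bool) : fps int :=
  fps_monomial int (if b then mu else nu).

(** The size bound in the conclusion involves neither p nor the size d of the given relation. *)
Lemma monomial_relation_mod_p p (n D : nat) (mu : 'I_n -> 'X_{1..m}) d :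
    prime p -> (forall s, mdeg (mu s) <= D)%N ->
    fps_dependent (fun s => fps_monomial int (mu s)) d 'F_p ->
  exists s t, s != t /\ fps_dependent (monomial_pair (mu s) (mu t)) D.+1 'F_p.
Proof.
move=> pp muD [c [c0 _ rel]].
have sB s : (size (lucas_factor p (mu s)) <= (D * p.-1).+1)%N.
  by apply: leq_trans (size_lucas_factor _ pp) _; rewrite ltnS leq_mul2r muD orbT.
have rel' : \sum_s poly_fps (c s) * fps_monomial 'F_p (mu s) = 0.
  by rewrite -[RHS]rel; apply: eq_bigr => s _; rewrite fps_map_monomial.
have [s [t [P [Q [st P0 sP sQ PQ]]]]] :=
  frobenius_relation pp (g := fun s => fps_monomial 'F_p (mu s))
    (fun s => fps_monomial_neq0 _ (mu s)) (fun s => fps_monomial_lucas (mu s) pp)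
    sB c0 rel'.
exists s, t; split=> //; exists (fun b => if b then Q else - P); split.
- by exists false; rewrite oppr_eq0.
- by case; rewrite ?size_polyN.
by rewrite big_bool /= !fps_map_monomial PQ rmorphN mulNr subrr.
Qed.

Lemma algebraic_relation_monomials (K : numFieldType) (L : numFieldType)
    (P : {mpoly {fraction {poly K}}[m]}) :
    P != 0 ->
    mmap (@ratfun_laurent K) (fun i => FracField.tofrac (nat_fps K (a i))) P = 0 ->
  exists (mu nu : 'X_{1..m}) (A B : {poly L}),
    [/\ mu != nu, A != 0, B != 0 &
      poly_fps A * fps_monomial L mu = poly_fps B * fps_monomial L nu].
Proof.
move=> P0 rel; set n := size (msupp P).
pose mu (s : 'I_n) := nth 0%MM (msupp P) s.
have mu_inj s t : s != t -> mu s != mu t.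
  by move=> st; rewrite nth_uniq ?msupp_uniq.
have [c [s0 cs0] crel] : exists2 c : 'I_n -> {poly K}, exists s, c s != 0 &
    \sum_s poly_fps (c s) * fps_monomial K (mu s) = 0.
  apply: (@ratfun_clear_denominators _ _ (fun s => P@_(mu s))).
    have n0 : (0 < n)%N by rewrite lt0n size_eq0 msupp_eq0.
    by exists (Ordinal n0); rewrite -mcoeff_msupp mem_nth.
  rewrite -[RHS]rel /mmap (big_nth 0%MM) big_mkord; apply: eq_bigr => s _.
  congr (_ * _); rewrite /mmap1 /fps_monomial rmorph_prod /=.
  by apply: eq_bigr => i _; rewrite rmorphXn.
pose D := \max_(s < n) mdeg (mu s); pose d := \max_s size (c s).
have muD s : (mdeg (mu s) <= D)%N by rewrite (leq_bigmax s).
have depK : fps_dependent (fun s => fps_monomial int (mu s)) d K.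
  exists c; split=> [|s|]; [by exists s0 | exact: leq_bigmax |].
  by rewrite -[RHS]crel; apply: eq_bigr => s _; rewrite fps_map_monomial.
(* A minor vanishing in characteristic zero is the integer 0, hence 0 modulo p. *)
have dep_p p : prime p -> fps_dependent (fun s => fps_monomial int (mu s)) d 'F_p.
  move=> pp; apply/fps_dependentP => phi.
  have /eqP := (fps_dependentP _ _ K).1 depK phi; rewrite intr_eq0 => /eqP ->.
  by rewrite mulr0z.
have [s [t [st [cL [[b0 cb0] _ relL]]]]] : exists s t, s != t /\
    fps_dependent (monomial_pair (mu s) (mu t)) D.+1 L.
  apply: contrapT => indep.
  (* If all pairs were independent over L, each would have a nonzero integral minor. A prime above
     their product divides none of them, yet modulo that prime some pair is dependent. *)
  have ex_phi (x : 'I_n * 'I_n) : exists phi, x.1 != x.2 ->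
      integral_minor (d := D.+1) (monomial_pair (mu x.1) (mu x.2)) phi != 0.
    case: x => s t /=.
    apply: contrapT => no_phi; case: (eqVneq s t) => [st|st].
      by apply: no_phi; exists (fun=> 0%N); rewrite st eqxx.
    apply: indep; exists s, t; split=> //; apply/fps_dependentP => phi.
    have [->|phi0] := eqVneq (integral_minor (monomial_pair (mu s) (mu t)) phi) 0.
      by rewrite mulr0z.
    by case: no_phi; exists phi.
  have [phi phi0] := boolp.choice ex_phi.
  pose M := (\prod_(x : 'I_n * 'I_n | x.1 != x.2)
     `|integral_minor (monomial_pair (mu x.1) (mu x.2)) (phi x)|)%N.
  have M0 : (0 < M)%N by apply: prodn_cond_gt0 => x /phi0; rewrite absz_gt0.
  have [p Mp pp] := prime_above M.
  have [s [t [st dep]]] := monomial_relation_mod_p pp muD (dep_p p pp).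
  have := (fps_dependentP _ _ 'F_p).1 dep (phi (s, t)).
  move/eqP; rewrite -(dvdz_pcharf (pchar_Fp pp)) dvdzE => /= p_dvd.
  have : (p %| M)%N by rewrite /M (bigD1 (s, t)) //= dvdn_mulr.
  by move/(dvdn_leq M0); rewrite leqNgt Mp.
pose Q := cL true; pose P' := - cL false.
have PQ : poly_fps Q * fps_monomial L (mu s) = poly_fps P' * fps_monomial L (mu t).
  apply/eqP; rewrite -subr_eq0 -mulNr -rmorphN opprK; apply/eqP.
  by rewrite -[RHS]relL big_bool /= !fps_map_monomial.
have QP0 : (Q == 0) = (P' == 0).
  rewrite -(poly_fps_eq0 Q) -(poly_fps_eq0 P').
  apply/eqP/eqP => h; move: PQ; rewrite h mul0r => /eqP.
    by rewrite eq_sym mulf_eq0 (negPf (fps_monomial_neq0 _ _)) orbF => /eqP.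
  by rewrite mulf_eq0 (negPf (fps_monomial_neq0 _ _)) orbF => /eqP.
have Q0 : Q != 0.
  case: b0 cb0 => //; rewrite -oppr_eq0 -/P'; by rewrite QP0.
exists (mu s), (mu t), Q, P'; split=> //; first exact: mu_inj.
by rewrite -QP0.
Qed.

End Criterion.

(** * The three families *)

Lemma pell_powers (s : RR) (D x z : nat) n : s ^+ 2 = D%:R -> (0 < x)%N -> (0 < z)%N ->
  exists a b : nat, [/\ (0 < a)%N, (0 < n)%N -> (0 < b)%N,
    (x%:R + z%:R * s) ^+ n = a%:R + b%:R * s &
    (x%:R - z%:R * s) ^+ n = a%:R - b%:R * s].
Proof.
move=> s2 x0 z0; elim: n => [|n [a [b [a0 _ IH1 IH2]]]].
  by exists 1%N, 0%N; rewrite !expr0 mul0r addr0 subr0.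
exists (x * a + D * z * b)%N, (z * a + x * b)%N; split.
- by rewrite addn_gt0 muln_gt0 x0 a0.
- by rewrite addn_gt0 muln_gt0 z0 a0.
- by rewrite exprS IH1 !natrD !natrM -s2; ring.
- by rewrite exprS IH2 !natrD !natrM -s2; ring.
Qed.

(* On the radii of the three families this is respectively not an integer, of the
   form 8 b^2, and of the form 20 b^2; the sixth power moves the golden ratio into
   Z[sqrt 5]. *)
Definition inv_gap (y : RR) : RR := ((y ^+ 6)^-1 - y ^+ 6) ^+ 2.

(** The Pell equation makes x - z s a unit of norm 1, so the inverse of its power a - b s is the
    conjugate a + b s and the gap is (2 b s)^2. *)
Lemma inv_gap_pell (s y : RR) (D x z n : nat) :
    s ^+ 2 = D%:R -> (0 < z)%N -> (x ^ 2 = D * z ^ 2 + 1)%N -> (0 < n)%N ->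
    y ^+ 6 = (x%:R - z%:R * s) ^+ n ->
  exists2 b, (0 < b)%N & inv_gap y = (4 * D * b ^ 2)%:R.
Proof.
move=> s2 z0 xz n0 yE.
have x0 : (0 < x)%N.
  by rewrite lt0n; apply: contra_eqN xz => /eqP ->; rewrite addn1.
have [a [b [_ b0 ab1 ab2]]] := pell_powers n s2 x0 z0.
exists b; first exact: b0.
have conj1 : (x%:R + z%:R * s) * (x%:R - z%:R * s) = 1.
  have -> : (x%:R + z%:R * s) * (x%:R - z%:R * s) = x%:R ^+ 2 - z%:R ^+ 2 * s ^+ 2 by ring.
  by rewrite s2 -!natrX xz natrD natrM; ring.
have inv1 : ((x%:R - z%:R * s) ^+ n)^-1 = (x%:R + z%:R * s) ^+ n.
  have h0 : (x%:R - z%:R * s) ^+ n != 0.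
    rewrite expf_neq0 //; apply: contra_eqN conj1 => /eqP ->.
    by rewrite mulr0 eq_sym oner_eq0.
  by apply: (mulIf h0); rewrite mulVf // -exprMn conj1 expr1n.
rewrite /inv_gap yE inv1 ab1 ab2 !natrM -s2; ring.
Qed.

Inductive series_family := Franel | Apery | Apery2.

Definition family_exp (T : series_family) (r : nat) : nat * nat :=
  match T with Franel => (r, 0) | Apery => (r, r) | Apery2 => (2 * r, r)%N end.

Definition family_start (T : series_family) : nat :=
  match T with Franel => 3 | Apery => 2 | Apery2 => 1 end.

Definition family_coef (T : series_family) (r : nat) : nat -> nat :=
  binsum (family_exp T r).1 (family_exp T r).2.

Lemma calF_family (K : fieldType) (f : fps K) : calF f ->
  exists T r, (family_start T <= r)%N /\ f = nat_fps K (family_coef T r).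
Proof.
case=> [[[r r3 <-]|[r r2 <-]]|[r r1 <-]].
- exists Franel, r; split=> //; apply: fpsP => n /=; congr (_%:R).
  by apply: eq_bigr => k _; rewrite expn0 muln1.
- by exists Apery, r.
- by exists Apery2, r.
Qed.

Local Notation sqrt2 := (Num.sqrt 2 : RR).
Local Notation sqrt5 := (Num.sqrt 5 : RR).

(** Solutions of [uvE] with v = u / (1 + u), after taking r-th roots: u = 1 - u, 2 u^2 = 1 and u^2 +
    u = 1. *)
Definition family_u (T : series_family) : RR :=
  match T with Franel => 1 / 2 | Apery => sqrt2 / 2 | Apery2 => (sqrt5 - 1) / 2 end.

Definition family_v (T : series_family) : RR :=
  match T with Franel => 1 / 3 | Apery => sqrt2 - 1 | Apery2 => ((sqrt5 - 1) / 2) ^+ 2 end.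

Definition family_base (T : series_family) : RR :=
  match T with Franel => 1 / 2 | Apery => 3 - 2 * sqrt2 | Apery2 => ((sqrt5 - 1) / 2) ^+ 5 end.

Lemma sqr_sqrt2 : sqrt2 ^+ 2 = 2. Proof. by rewrite sqr_sqrtr ?ler0n. Qed.
Lemma sqr_sqrt5 : sqrt5 ^+ 2 = 5. Proof. by rewrite sqr_sqrtr ?ler0n. Qed.

Lemma family_u01 T : 0 < family_u T < 1.
Proof.
have s2 := sqr_sqrt2; have s5 := sqr_sqrt5.
have s2_0 : 0 <= sqrt2 := sqrtr_ge0 _; have s5_0 : 0 <= sqrt5 := sqrtr_ge0 _.
by case: T => /=; apply/andP; split; nra.
Qed.

Lemma family_vE T : family_v T * (1 + family_u T) = family_u T.
Proof.
have s2 := sqr_sqrt2; have s5 := sqr_sqrt5; case: T => /=; [by field|nra|].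
have u2 : ((sqrt5 - 1) / 2) ^+ 2 = 1 - (sqrt5 - 1) / 2 by nra.
by rewrite u2; nra.
Qed.

Lemma family_uvE T r : let e := family_exp T r in
  family_u T ^+ e.1 * family_v T ^+ e.2 = (1 - family_u T) ^+ e.1.
Proof.
have s2 := sqr_sqrt2; have s5 := sqr_sqrt5; case: T => /=.
- by rewrite expr0 mulr1; congr (_ ^+ _); field.
- by rewrite -exprMn; congr (_ ^+ _); nra.
have u2 : ((sqrt5 - 1) / 2) ^+ 2 = 1 - (sqrt5 - 1) / 2 by nra.
by rewrite -u2 exprM -exprMn [RHS]exprM; congr (_ ^+ _); ring.
Qed.

Definition family_radius T r : RR :=
  binsum_radius (family_exp T r).1 (family_exp T r).2 (family_u T) (family_v T).

Lemma family_radiusE T r : family_radius T r = family_base T ^+ r.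
Proof.
have s2 := sqr_sqrt2; have s5 := sqr_sqrt5; rewrite /family_radius /binsum_radius.
case: T => /=.
- by rewrite expr0 mulr1; congr (_ ^+ _); field.
- by rewrite -exprMn; congr (_ ^+ _); nra.
have u2 : ((sqrt5 - 1) / 2) ^+ 2 = 1 - (sqrt5 - 1) / 2 by nra.
rewrite exprM -exprMn; congr (_ ^+ _).
have -> : 1 - ((sqrt5 - 1) / 2) ^+ 2 = (sqrt5 - 1) / 2 by lra.
by rewrite -u2; ring.
Qed.

Lemma family_base01 T : 0 < family_base T < 1.
Proof.
have s2 := sqr_sqrt2; have s5 := sqr_sqrt5.
have s2_0 : 0 <= sqrt2 := sqrtr_ge0 _.
case: T => /=; [apply/andP; split; lra | apply/andP; split; nra |].
have /andP[u0 u1] := family_u01 Apery2; rewrite exprn_gt0 //=.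
by rewrite exprn_ilt1 // ltW.
Qed.

(** For N = 2^(6r), an integral gap b would give N^4 + 1 = (b + 2) N^2, contradicting parity. *)
Lemma inv_gap_franel r b : (0 < r)%N -> inv_gap (family_radius Franel r) <> b%:R.
Proof.
move=> r0; rewrite family_radiusE /= /inv_gap => gap.
pose N := (2 ^ (r * 6))%N; have N0 : N%:R != 0 :> RR by rewrite pnatr_eq0 expn_eq0.
have yE : ((1 / 2) ^+ r) ^+ 6 = N%:R^-1 :> RR.
  by rewrite -exprM mul1r exprVn natrX.
rewrite yE invrK in gap.
have /eqP : (N ^ 4 + 1)%:R = ((b + 2) * N ^ 2)%:R :> RR.
  by rewrite natrD natrX natrM natrX natrD -gap; field.
rewrite eqr_nat => /eqP NE.
have N2 : (2 %| N)%N by rewrite /N dvdn_exp // muln_gt0 r0.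
have : (2 %| N ^ 4 + 1)%N by rewrite NE dvdn_mull // dvdn_exp.
by rewrite dvdn_addr // dvdn_exp.
Qed.

Lemma inv_gap_apery r : (0 < r)%N ->
  exists2 b, (0 < b)%N & inv_gap (family_radius Apery r) = (4 * 2 * b ^ 2)%:R.
Proof.
move=> r0; apply: (@inv_gap_pell sqrt2 _ 2 3 2 (r * 6)) => //.
- exact: sqr_sqrt2.
- by rewrite muln_gt0 r0.
- by rewrite family_radiusE /= exprM.
Qed.

Lemma inv_gap_apery2 r : (0 < r)%N ->
  exists2 b, (0 < b)%N & inv_gap (family_radius Apery2 r) = (4 * 5 * b ^ 2)%:R.
Proof.
move=> r0; apply: (@inv_gap_pell sqrt5 _ 5 9 4 (5 * r)) => //.
- exact: sqr_sqrt5.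
- by rewrite muln_gt0 r0.
rewrite family_radiusE /=; have s5 := sqr_sqrt5.
have u2 : ((sqrt5 - 1) / 2) ^+ 2 = 1 - (sqrt5 - 1) / 2 by nra.
(* The cube, sqrt 5 - 2, is integral but has norm -1; squaring it gives norm 1, with 9^2 = 5 * 4^2 +
   1. *)
have u6 : ((sqrt5 - 1) / 2) ^+ 6 = 9 - 4 * sqrt5.
  have u3 : (sqrt5 - 1) / 2 * ((sqrt5 - 1) / 2) ^+ 2 = sqrt5 - 2.
    by rewrite u2 mulrBr mulr1 -expr2 u2; field.
  transitivity ((sqrt5 - 2) ^+ 2); first by rewrite -u3; ring.
  have -> : (sqrt5 - 2) ^+ 2 = sqrt5 ^+ 2 - 4 * sqrt5 + 4 by ring.
  by rewrite s5; ring.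
by rewrite -exprM -exprM -u6 -exprM; congr (_ ^+ _); lia.
Qed.

Lemma family_radius_inj T r T' r' : (0 < r)%N -> (0 < r')%N ->
  family_radius T r = family_radius T' r' -> T = T' /\ r = r'.
Proof.
move=> r0 r'0 rr.
(* The 2-adic valuation of 8 b^2 is odd, that of 20 d^2 even. *)
have apery_ne b d : (0 < b)%N -> (0 < d)%N -> (4 * 2 * b ^ 2)%:R <> (4 * 5 * d ^ 2)%:R :> RR.
  move=> b0 d0 /eqP; rewrite eqr_nat => /eqP /(congr1 (logn 2)).
  rewrite !lognM ?muln_gt0 ?b0 ?d0 //.
  have -> : logn 2 4 = 2%N by []. have -> : logn 2 2 = 1%N by []. have -> : logn 2 5 = 0%N by [].
  lia.
have gap := congr1 inv_gap rr.
suff TT : T = T'.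
  split=> //; move: rr; rewrite -TT !family_radiusE.
  have /andP[b0 b1] := family_base01 T; apply: ieexprIn => //.
  by rewrite lt_eqF.
case: T T' rr gap => [] [] // _ gap.
- by have [b _ h] := inv_gap_apery r'0; case: (inv_gap_franel r0 (etrans gap h)).
- by have [b _ h] := inv_gap_apery2 r'0; case: (inv_gap_franel r0 (etrans gap h)).
- by have [b _ h] := inv_gap_apery r0; case: (inv_gap_franel r'0 (etrans (esym gap) h)).
- have [b b0 h] := inv_gap_apery r0; have [d d0 h'] := inv_gap_apery2 r'0.
  by case: (apery_ne b d b0 d0); rewrite -h -h'.
- by have [b _ h] := inv_gap_apery2 r0; case: (inv_gap_franel r'0 (etrans (esym gap) h)).
- have [b b0 h] := inv_gap_apery2 r0; have [d d0 h'] := inv_gap_apery r'0.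
  by case: (apery_ne d b d0 b0); rewrite -h -h'.
Qed.

Lemma family_radius_gt0 T r : 0 < family_radius T r.
Proof. exact: binsum_radius_gt0 (family_u01 T) (family_vE T). Qed.

Lemma family_coef0 T r : family_coef T r 0 = 1%N.
Proof. by rewrite /family_coef /binsum big_ord1 bin0 !exp1n. Qed.

Section FamilyMember.
Variables (T : series_family) (r : nat).
Hypothesis start_r : (family_start T <= r)%N.

Lemma family_start_gt0 : (0 < r)%N.
Proof. by case: T start_r => /= Tr; lia. Qed.

Lemma family_exp_gt0 : (0 < (family_exp T r).1)%N.
Proof. by case: T start_r => /= Tr; lia. Qed.

(** In each family the starting value is the least r with this property. *)
Lemma family_exp_ge3 : (3 <= (family_exp T r).1 + (family_exp T r).2)%N.
Proof. by case: T start_r => /= Tr; lia. Qed.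

Lemma family_upper : exists C, forall n,
  n%:R * fps_coef (nat_fps RR (family_coef T r)) n * family_radius T r ^+ n <= C.
Proof.
exact: binsum_upper (family_u01 T) (family_vE T) (family_uvE T r) family_exp_gt0
  family_exp_ge3.
Qed.

Lemma family_lower : exists N, exists2 c : RR, 0 < c & forall n,
  c <= fps_coef (nat_fps RR (family_coef T r)) n * family_radius T r ^+ n * n.+1%:R ^+ N.
Proof.
exists ((family_exp T r).1 + (family_exp T r).2)%N.
exists ((1 / 2) ^+ ((family_exp T r).1 + (family_exp T r).2)).
  by rewrite exprn_gt0 // divr_gt0.
exact: binsum_lower (family_u01 T) (family_vE T) (family_uvE T r).
Qed.

Lemma family_conv x : 0 <= x < family_radius T r ->
  fps_conv x (nat_fps RR (family_coef T r)) /\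
  fps_eval (nat_fps RR (family_coef T r)) x != 0.
Proof.
move=> xr; have [C upper] := family_upper.
have F0 : fps_coef (nat_fps RR (family_coef T r)) 0 = 1 by rewrite /= family_coef0.
have F_ge0 n : 0 <= fps_coef (nat_fps RR (family_coef T r)) n by rewrite /= ler0n.
have rho0 := family_radius_gt0 T r; split.
  exact: (singular_conv rho0 F0 F_ge0 upper xr).
by rewrite gt_eqF // (lt_le_trans ltr01) // (singular_ge1 rho0 F0 F_ge0 upper xr).
Qed.

End FamilyMember.

(** * Independence of the family *)

Lemma family_monomials_independent m (T : 'I_m -> series_family) (r : 'I_m -> nat)
    (mu nu : 'X_{1..m}) (A B : {poly RR}) :
    (forall i, family_start (T i) <= r i)%N ->
    (forall i j, T i = T j -> r i = r j -> i = j) ->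
    mu != nu -> A != 0 -> B != 0 ->
  poly_fps A * fps_monomial (fun i => family_coef (T i) (r i)) RR mu <>
  poly_fps B * fps_monomial (fun i => family_coef (T i) (r i)) RR nu.
Proof.
move=> start Tr_inj mu_nu A0 B0 rel.
pose rho i := family_radius (T i) (r i).
have rho_inj : injective rho.
  by move=> i j /family_radius_inj[||/Tr_inj]; [exact: family_start_gt0 ..|auto].
have [i1 i1P] : exists i, mu i != nu i.
  apply: contra_notP (elimN eqP mu_nu) => /forallNP eq_i; apply/mnmP => i.
  by have /negP/negPn/eqP := eq_i i.
have [i0 i0P i0_min] := @arg_minP _ _ _ i1 (fun i => mu i != nu i) rho i1P.
wlog lt_i0 : mu nu A B mu_nu A0 B0 rel {i1 i1P} i0P i0_min / (nu i0 < mu i0)%N.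
  move=> W; have [|lt_i0|//] := ltngtP (nu i0) (mu i0); first exact: (W mu nu A B).
    apply: (W nu mu B A) => //; rewrite 1?eq_sym // => j; rewrite eq_sym; exact: i0_min.
  by move=> /eqP; rewrite eq_sym (negPf i0P).
pose f i := nat_fps RR (family_coef (T i) (r i)).
have f_neq0 i : f i != 0.
  exact: (@nat_fps_neq0 m (fun i => family_coef (T i) (r i)) (fun i => family_coef0 _ _)).
have rho0 i : 0 < rho i by apply: family_radius_gt0.
pose good (g : fps RR) := fps_conv (rho i0) g /\ fps_eval g (rho i0) != 0.
have good1 : good 1.
  rewrite /good -(rmorph1 (@poly_fps RR)) fps_eval_poly ?hornerC ?oner_eq0 ?(ltW (rho0 _)) //.
  by split=> //; apply/fps_conv_poly/ltW.
have goodM g h : good g -> good h -> good (g * h).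
  move=> [cg g0] [ch h0]; have rho0' := ltW (rho0 i0).
  by split; [apply: fps_convM | rewrite fps_evalM // mulf_neq0].
have goodX i k : (i != i0 -> (0 < k)%N -> mu i != nu i) -> (i = i0 -> k = 0%N) ->
    good (f i ^+ k).
  move=> ik i0k; have [/i0k ->|ii0] := eqVneq i i0; first by rewrite expr0.
  case: k ik {i0k} => [|k] ik; first by rewrite expr0.
  have lt_rho : rho i0 < rho i.
    by rewrite lt_neqAle (inj_eq rho_inj) eq_sym ii0 i0_min // ik.
  elim: k.+1 => [|n IHn]; first by rewrite expr0.
  rewrite exprS; apply: goodM IHn; apply: family_conv => //.
  by rewrite ltW ?rho0.
(* The common factor W is cancelled; by truncated subtraction each remaining factor stays on one
   side, and [i0] has exponent 0 in H. So G and H contain only series of radius larger than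
   [rho i0]. *)
pose G := \prod_(i | i != i0) f i ^+ (mu i - nu i).
pose H := \prod_i f i ^+ (nu i - mu i).
pose W := \prod_i f i ^+ minn (mu i) (nu i).
have [cG G0] : good G.
  apply: (big_ind good) => // i ii0; apply: goodX => [_|i_i0]; last by rewrite i_i0 eqxx in ii0.
  by rewrite subn_gt0 neq_ltn orbC => ->.
have [cH H0] : good H.
  apply: (big_ind good) => // i _; apply: goodX => [_|->].
    by rewrite subn_gt0 neq_ltn => ->.
  by apply/eqP; rewrite subn_eq0 ltnW.
have W0 : W != 0 by apply/prodf_neq0 => i _; rewrite expf_neq0.
have muE : fps_monomial (fun i => family_coef (T i) (r i)) RR mu =
    W * (f i0 ^+ (mu i0 - nu i0).-1.+1 * G).
  transitivity (W * \prod_i f i ^+ (mu i - nu i)); last first.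
    by rewrite [\prod_i f i ^+ _](bigD1 i0) //= prednK ?subn_gt0.
  rewrite /W -big_split; apply: eq_bigr => i _; rewrite /= -exprD; congr (_ ^+ _).
  by lia.
have nuE : fps_monomial (fun i => family_coef (T i) (r i)) RR nu = W * H.
  rewrite /W /H -big_split; apply: eq_bigr => i _; rewrite /= -exprD; congr (_ ^+ _).
  by lia.
have [C upper] := family_upper (start i0); have [N [c c0 lower]] := family_lower (T i0) (r i0).
apply: (singular_rational_relation_false (rho := rho i0) (F := f i0) (C := C) (N := N) (c := c)
  _ _ _ _ _ _ (a := (mu i0 - nu i0).-1) cG cH G0 H0 B0 A0) => //.
- by rewrite /= family_coef0.
apply: (mulfI W0); rewrite [in RHS]mulrA -nuE [RHS]mulrC -rel muE.
by rewrite [LHS]mulrA [LHS]mulrC.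
Qed.

Local Open Scope classical_set_scope.

Theorem theorem9p8 (R : realType) :
  algebraically_independent (@ratfun_laurent R[i])
    [set FracField.tofrac f | f in @calF R[i]].
Proof.
move=> m x x_inj xF P relP; apply/eqP; apply: contraT => P0.
have /boolp.choice[Tr TrP] : forall i, exists Tr : series_family * nat,
    (family_start Tr.1 <= Tr.2)%N /\
    x i = FracField.tofrac (nat_fps R[i] (family_coef Tr.1 Tr.2)).
  move=> i; have [f /calF_family[T [r [Tr ->]]] <-] := xF i.
  by exists (T, r).
pose a i := family_coef (Tr i).1 (Tr i).2.
have a0 i : a i 0%N = 1%N by apply: family_coef0.
have a_lucas p : prime p -> forall i, lucas_seq p (a i).
  by move=> pp i; apply: lucas_binsum => //; apply: family_exp_gt0; case: (TrP i).
have xE : x = fun i => FracField.tofrac (nat_fps R[i] (a i)).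
  by apply/funext => i; case: (TrP i).
rewrite xE in relP.
(* Here the complex relation is exchanged for a real one between two monomials. *)
have [mu [nu [A [B [mu_nu A0 B0 rel]]]]] :=
  algebraic_relation_monomials a0 a_lucas RR P0 relP.
case: (family_monomials_independent _ _ mu_nu A0 B0 rel).
  by move=> i; case: (TrP i).
move=> i j T_ij r_ij; apply: x_inj; rewrite xE /a; by rewrite T_ij r_ij.
Qed.
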